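(* Let $L>0$ and let $\theta$, on an interval $I\ni0$, be a solution of $$\Bigl(\frac{H'}{k_1}\Bigr)'+\Bigl(\frac{H'}{k_1}\Bigr)^2+\frac{\cosh\theta}{L}\frac{H'}{k_1}+k_1^2+\frac{\sinh^2\theta}{L^2}-\frac2{L^2}=0,\qquad k_1=\theta'+\frac{\sinh\theta}{L}\neq0,\quad H=-\frac{\theta'}2-\frac{\sinh\theta}{L}.$$ Define $\rho$ and $Y$ by $$\rho'=\frac{\cosh\theta}{L}\rho,\quad\rho(0)=\rho_0>0,\qquad Y'=\frac{\cosh\theta}{L}Y+\sinh\theta,\quad Y(0)=Y_0,$$ set $V=\frac{L^2-Y^2}{2\rho}$, and, in null coordinates $(U,V,Y,Z)$ of $\mathbb R^{2,2}$ with metric $-2\,dU\,dV-dY^2+dZ^2$, define $$X(s,t)=\Bigl(\rho,\;V+\tfrac12t^2\rho,\;Y,\;t\rho\Bigr),\qquad (s,t)\in I\times J,$$ with $J\subset\mathbb R$ an interval. Then $X$ takes values in $\mathrm{AdS}_3(L)$ and is a spacelike immersion with induced metric $g=ds^2+\rho(s)^2dt^2$. With a suitable timelike unit normal, its principal curvatures (along $\partial_s$ and $\partial_t$ respectively) are $$k_1=\theta'+\frac{\sinh\theta}L,\qquad k_2=\frac{\sinh\theta}L.$$ Consequently, let $\theta$ be the local real-analytic solution with initial data $\theta(0)=\theta_0$, $\theta'(0)=a_0$, $\theta''(0)=b_0$ satisfying $k_{1,0}\neq0$, $H_0\neq0$, $H_0'\neq0$, $H_0\neq k_{1,0}$, where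 $k_{1,0}=a_0+\frac{\sinh\theta_0}{L}$, $H_0=-\frac{a_0}2-\frac{\sinh\theta_0}L$, $H_0'=-\frac{b_0}2-\frac{a_0\cosh\theta_0}L$; let $u(s)=u_0\exp\bigl[\int_0^s\frac{H'}{k_1}d\tau\bigr]$ with $u_0/H_0>0$, let $\lambda^2=u/H$, and let $I$ be a sufficiently small interval around $0$. Then the map $$X:\bigl(I\times J,\lambda^{-2}(ds^2+\rho^2dt^2)\bigr)\to\mathrm{AdS}_3(L)$$ is a proper biharmonic conformal immersion with parabolic rotational symmetry.
   Context: In the null coordinates $(U,V,Y,Z)$, $\mathbb R^{2,2}$ has scalar product $\langle X,X\rangle=-2UV-Y^2+Z^2$, and $\mathrm{AdS}_3(L)=\{\langle X,X\rangle=-L^2\}$ with the induced Lorentzian metric of constant curvature $-1/L^2$. The immersion is $X(s,t)=\mathcal P_t(\rho(s),V(s),Y(s),0)$, where $\mathcal P_t(U,V,Y,Z)=(U,\,V+tZ+\frac12t^2U,\,Y,\,Z+tU)$ is a one-parameter subgroup of $O(2,2)$ whose generator $\mathcal B$ satisfies $\mathcal B^3=0$, $\mathcal B^2\neq0$; parabolic rotational symmetry refers to this action. The shape operator is $A$ with $\nabla^N_W\xi=-AW$ for the unit normal $\xi$ ($\langle\xi,\xi\rangle=-1$), the principal curvatures are its eigenvalues, and the scalar mean curvature is $H=-\frac12\operatorname{tr}_gA$ (mean-curvature vector $=H\xi$). For a smooth map $\phi:(M,g')\to(N,h)$ between pseudo-Riemannian manifolds, $\tau_{g'}(\phi)=\operatorname{tr}_{g'}\nabla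 d\phi$ and $\tau_{2,g'}(\phi)=\Delta^\phi_{g'}\tau_{g'}(\phi)-\sum_i\epsilon_iR^N(d\phi(e_i),\tau_{g'}(\phi))d\phi(e_i)$, where $\{e_i\}$ is a local $g'$-pseudo-orthonormal frame with $g'(e_i,e_j)=\epsilon_i\delta_{ij}$, $\Delta^\phi_{g'}V=\sum_i\epsilon_i(\nabla^\phi_{e_i}\nabla^\phi_{e_i}V-\nabla^\phi_{\nabla_{e_i}e_i}V)$, and $R^N(X,Y)=[\nabla^N_X,\nabla^N_Y]-\nabla^N_{[X,Y]}$. The map is biharmonic if $\tau_{2,g'}(\phi)=0$; proper biharmonic means biharmonic but not harmonic ($\tau_{g'}(\phi)\not\equiv0$). Primes denote $d/ds$. *)

(* Defs.v *)
(* Stdlib real numbers and Coquelicot. *)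
From Stdlib Require Import Reals Lra.
From Coquelicot Require Import Coquelicot.
Open Scope R_scope.

(** * R^{2,2} in null coordinates, and AdS_3(L) *)

Record vec4 : Type := Vec { cU : R; cV : R; cY : R; cZ : R }.

Definition vzero : vec4 := Vec 0 0 0 0.

Definition vadd (x y : vec4) : vec4 :=
  Vec (cU x + cU y) (cV x + cV y) (cY x + cY y) (cZ x + cZ y).

Definition vscal (a : R) (x : vec4) : vec4 :=
  Vec (a * cU x) (a * cV x) (a * cY x) (a * cZ x).

Definition vopp (x : vec4) : vec4 := vscal (-1) x.
Definition vsub (x y : vec4) : vec4 := vadd x (vopp y).

(* The polarization of <X,X> = -2 U V - Y^2 + Z^2. *)
Definition sprod (x y : vec4) : R :=
  - (cU x * cV y + cV x * cU y) - cY x * cY y + cZ x * cZ y.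

Definition AdS (L : R) (p : vec4) : Prop := sprod p p = - L ^ 2.

(* For p in AdS_3(L), the orthogonal projection of R^{2,2} onto
   T_p AdS_3(L) = p^\perp; recall <p,p> = - L^2. *)
Definition proj (L : R) (p w : vec4) : vec4 :=
  vadd w (vscal (sprod w p / L ^ 2) p).

(** * Levi-Civita connection and curvature of AdS_3(L)

    Vector fields on AdS_3(L) are represented by maps defined on all of
    R^{2,2}; only their derivatives in directions tangent to AdS_3(L) matter.
    The Levi-Civita connection of the induced metric is the tangential part
    of the flat connection of R^{2,2}. *)

Definition dirD (F : vec4 -> vec4) (p x : vec4) : vec4 :=
  Vec (Derive (fun r => cU (F (vadd p (vscal r x)))) 0)
      (Derive (fun r => cV (F (vadd p (vscal r x)))) 0)
      (Derive (fun r => cY (F (vadd p (vscal r x)))) 0)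
      (Derive (fun r => cZ (F (vadd p (vscal r x)))) 0).

Definition nablaN (L : R) (A F : vec4 -> vec4) (p : vec4) : vec4 :=
  proj L p (dirD F p (A p)).

Definition bracketN (A B : vec4 -> vec4) (p : vec4) : vec4 :=
  vsub (dirD B p (A p)) (dirD A p (B p)).

Definition curvN (L : R) (A B F : vec4 -> vec4) (p : vec4) : vec4 :=
  vsub (vsub (nablaN L A (nablaN L B F) p) (nablaN L B (nablaN L A F) p))
       (nablaN L (bracketN A B) F p).

(* A vector field on AdS_3(L) with value x at p, for x tangent at p. *)
Definition extend (L : R) (x : vec4) : vec4 -> vec4 := fun q => proj L q x.

(* R^N(x,y)z for x, y, z in T_p AdS_3(L); as [curvN] is tensorial, the choice
   of the extensions is immaterial. *)
Definition RN (L : R) (p x y z : vec4) : vec4 :=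
  curvN L (extend L x) (extend L y) (extend L z) p.

(** * Calculus on domains of the (s,t)-plane *)

Inductive axis : Set := Ds | Dt.

Definition sum2 (f : axis -> R) : R := f Ds + f Dt.
Definition vsum2 (f : axis -> vec4) : vec4 := vadd (f Ds) (f Dt).
Definition delta (i j : axis) : R :=
  match i, j with Ds, Ds | Dt, Dt => 1 | _, _ => 0 end.

(* A tangent vector is given by its components with respect to the coordinate
   fields d/ds and d/dt. *)
Definition tvec : Type := axis -> R.
Definition field : Type := R -> R -> tvec.
Definition coord (i : axis) : tvec := delta i.
Definition coordf (i : axis) : field := fun _ _ => coord i.

Definition pd (i : axis) (f : R -> R -> R) (s t : R) : R :=
  match i with
  | Ds => Derive (fun x => f x t) s
  | Dt => Derive (fun y => f s y) t
  end.

Definition vpd (i : axis) (sig : R -> R -> vec4) (s t : R) : vec4 :=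
  Vec (pd i (fun x y => cU (sig x y)) s t) (pd i (fun x y => cV (sig x y)) s t)
      (pd i (fun x y => cY (sig x y)) s t) (pd i (fun x y => cZ (sig x y)) s t).

Definition plane_domain : Type := R -> R -> Prop.

Definition open_domain (D : plane_domain) : Prop :=
  forall s t, D s t -> locally_2d D s t.

Fixpoint Ck (k : nat) (D : plane_domain) (f : R -> R -> R) : Prop :=
  (forall s t, D s t -> continuity_2d_pt f s t) /\
  match k with
  | O => True
  | S m =>
      (forall s t, D s t ->
         ex_derive (fun x => f x t) s /\ ex_derive (fun y => f s y) t) /\
      (forall i, Ck m D (pd i f))
  end.

Definition smooth (D : plane_domain) (f : R -> R -> R) : Prop :=
  forall k, Ck k D f.

Definition smooth_map (D : plane_domain) (phi : R -> R -> vec4) : Prop :=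
  smooth D (fun s t => cU (phi s t)) /\ smooth D (fun s t => cV (phi s t)) /\
  smooth D (fun s t => cY (phi s t)) /\ smooth D (fun s t => cZ (phi s t)).

Definition is_open_interval (I : R -> Prop) : Prop :=
  open I /\ forall a b c, I a -> I b -> a <= c <= b -> I c.

Definition rect (I J : R -> Prop) : plane_domain := fun s t => I s /\ J t.

Definition analytic_on (I : R -> Prop) (f : R -> R) : Prop :=
  forall x, I x -> exists (a : nat -> R) (r : R),
    0 < r /\ forall h : R, Rabs h < r -> is_pseries a h (f (x + h)).

(** * Metrics on domains of the plane *)

Definition metric : Type := R -> R -> axis -> axis -> R.

Definition ip (g : metric) (s t : R) (v w : tvec) : R :=
  sum2 (fun i => sum2 (fun j => g s t i j * v i * w j)).

Definition detg (g : metric) (s t : R) : R :=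
  g s t Ds Ds * g s t Dt Dt - g s t Ds Dt * g s t Dt Ds.

Definition pseudo_metric (D : plane_domain) (g : metric) : Prop :=
  (forall i j, smooth D (fun s t => g s t i j)) /\
  (forall s t i j, D s t -> g s t i j = g s t j i) /\
  (forall s t, D s t -> detg g s t <> 0).

Definition ginv (g : metric) (s t : R) (i j : axis) : R :=
  match i, j with
  | Ds, Ds => g s t Dt Dt / detg g s t
  | Dt, Dt => g s t Ds Ds / detg g s t
  | Ds, Dt => - g s t Ds Dt / detg g s t
  | Dt, Ds => - g s t Dt Ds / detg g s t
  end.

(* christoffel g s t k i j is Gamma^k_{ij}. *)
Definition christoffel (g : metric) (s t : R) (k i j : axis) : R :=
  / 2 * sum2 (fun l => ginv g s t k l *
    (pd i (fun x y => g x y j l) s t + pd j (fun x y => g x y i l) s t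
     - pd l (fun x y => g x y i j) s t)).

Definition nablaM (g : metric) (V W : field) : field := fun s t k =>
  sum2 (fun i => V s t i * (pd i (fun x y => W x y k) s t
    + sum2 (fun j => christoffel g s t k i j * W s t j))).

(* A g-pseudo-orthonormal frame on D, with g(e_i,e_j) = eps_i delta_ij. *)
Definition is_frame (D : plane_domain) (g : metric) (eps : axis -> R)
    (e : axis -> field) : Prop :=
  (forall i, eps i = 1 \/ eps i = -1) /\
  (forall i k, smooth D (fun s t => e i s t k)) /\
  (forall s t i j, D s t -> ip g s t (e i s t) (e j s t) = eps i * delta i j).

(** * Maps from planar domains to AdS_3(L) *)

(* Derivative along v of an R^{2,2}-valued map; in particular
   [ddir v phi s t] is d phi(v) at (s,t). *)
Definition ddir (v : tvec) (sig : R -> R -> vec4) (s t : R) : vec4 :=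
  vsum2 (fun i => vscal (v i) (vpd i sig s t)).

(* The connection of the pull-back bundle phi^* T AdS_3(L), applied to a
   section sig, in the direction v. *)
Definition nablaP (L : R) (phi : R -> R -> vec4) (v : tvec)
    (sig : R -> R -> vec4) (s t : R) : vec4 :=
  proj L (phi s t) (ddir v sig s t).

(* (nabla d phi)(V,W) *)
Definition nabla_d (L : R) (g : metric) (phi : R -> R -> vec4) (V W : field)
    (s t : R) : vec4 :=
  vsub (nablaP L phi (V s t) (fun x y => ddir (W x y) phi x y) s t)
       (ddir (nablaM g V W s t) phi s t).

Definition tension (L : R) (g : metric) (phi : R -> R -> vec4) (s t : R)
    : vec4 :=
  vsum2 (fun i => vsum2 (fun j =>
    vscal (ginv g s t i j) (nabla_d L g phi (coordf i) (coordf j) s t))).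

Definition rough_laplacian (L : R) (g : metric) (eps : axis -> R)
    (e : axis -> field) (phi sig : R -> R -> vec4) (s t : R) : vec4 :=
  vsum2 (fun i => vscal (eps i)
    (vsub (nablaP L phi (e i s t)
             (fun x y => nablaP L phi (e i x y) sig x y) s t)
          (nablaP L phi (nablaM g (e i) (e i) s t) sig s t))).

Definition bitension (L : R) (g : metric) (eps : axis -> R)
    (e : axis -> field) (phi : R -> R -> vec4) (s t : R) : vec4 :=
  vsub (rough_laplacian L g eps e phi (tension L g phi) s t)
       (vsum2 (fun i => vscal (eps i)
          (RN L (phi s t) (ddir (e i s t) phi s t) (tension L g phi s t)
             (ddir (e i s t) phi s t)))).

Definition smooth_into_AdS (L : R) (D : plane_domain) (phi : R -> R -> vec4)
    : Prop :=
  smooth_map D phi /\ forall s t, D s t -> AdS L (phi s t).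

(* The bitension field vanishes, computed in any local pseudo-orthonormal
   frame; such frames exist near every point of D. *)
Definition biharmonic (L : R) (D : plane_domain) (g : metric)
    (phi : R -> R -> vec4) : Prop :=
  smooth_into_AdS L D phi /\ pseudo_metric D g /\
  forall (W : plane_domain) (eps : axis -> R) (e : axis -> field),
    open_domain W -> (forall s t, W s t -> D s t) -> is_frame W g eps e ->
    forall s t, W s t -> bitension L g eps e phi s t = vzero.

Definition proper_biharmonic (L : R) (D : plane_domain) (g : metric)
    (phi : R -> R -> vec4) : Prop :=
  biharmonic L D g phi /\
  exists s t, D s t /\ tension L g phi s t <> vzero.

Definition immersion (D : plane_domain) (phi : R -> R -> vec4) : Prop :=
  smooth_map D phi /\
  forall s t (v : tvec), D s t -> ddir v phi s t = vzero ->
    forall i, v i = 0.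

Definition pullback (phi : R -> R -> vec4) (s t : R) (v w : tvec) : R :=
  sprod (ddir v phi s t) (ddir w phi s t).

Definition spacelike_immersion (D : plane_domain) (phi : R -> R -> vec4) : Prop :=
  immersion D phi /\
  forall s t (v : tvec), D s t -> (exists i, v i <> 0) ->
    0 < pullback phi s t v v.

Definition conformal_immersion (L : R) (D : plane_domain) (g : metric)
    (phi : R -> R -> vec4) : Prop :=
  smooth_into_AdS L D phi /\ pseudo_metric D g /\ immersion D phi /\
  exists mu : R -> R -> R, smooth D mu /\
    forall s t, D s t -> 0 < mu s t /\
      forall v w, pullback phi s t v w = mu s t ^ 2 * ip g s t v w.

(* xi is a smooth timelike unit normal field, tangent to AdS_3(L), along phi. *)
Definition timelike_unit_normal (D : plane_domain) (phi xi : R -> R -> vec4)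
    : Prop :=
  smooth_map D xi /\
  forall s t, D s t ->
    sprod (xi s t) (xi s t) = -1 /\ sprod (xi s t) (phi s t) = 0 /\
    forall v, sprod (xi s t) (ddir v phi s t) = 0.

Definition mxapp (A : axis -> axis -> R) (v : tvec) : tvec :=
  fun i => sum2 (fun j => A i j * v j).

(* A is the matrix of the shape operator at (s,t): nabla^N_W xi = - d phi(A W). *)
Definition is_shape_operator (L : R) (phi xi : R -> R -> vec4) (s t : R)
    (A : axis -> axis -> R) : Prop :=
  forall W : tvec,
    nablaP L phi W xi s t = vopp (ddir (mxapp A W) phi s t).

Definition principal_curvature_along (A : axis -> axis -> R) (k : R)
    (v : tvec) : Prop :=
  (exists i, v i <> 0) /\ forall i, mxapp A v i = k * v i.

(** * Parabolic rotations *)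

Definition parab (t : R) (p : vec4) : vec4 :=
  Vec (cU p) (cV p + t * cZ p + / 2 * t ^ 2 * cU p) (cY p) (cZ p + t * cU p).

Definition parab_gen (p : vec4) : vec4 := Vec 0 (cZ p) 0 (cU p).

Lemma parab_0 p : parab 0 p = p.
Proof. destruct p; unfold parab; cbn; f_equal; field. Qed.

Lemma parab_plus r t p : parab (r + t) p = parab r (parab t p).
Proof. unfold parab; cbn; f_equal; field. Qed.

Lemma parab_isometry t p q : sprod (parab t p) (parab t q) = sprod p q.
Proof. unfold sprod, parab; cbn; field. Qed.

Lemma parab_derive_0 p :
  is_derive (fun t => cU (parab t p)) 0 (cU (parab_gen p)) /\
  is_derive (fun t => cV (parab t p)) 0 (cV (parab_gen p)) /\
  is_derive (fun t => cY (parab t p)) 0 (cY (parab_gen p)) /\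
  is_derive (fun t => cZ (parab t p)) 0 (cZ (parab_gen p)).
Proof.
  destruct p as [u v y z]; unfold parab; cbn [cU cV cY cZ parab_gen].
  split; [|split; [|split]]; auto_derive; trivial; field.
Qed.

Lemma parab_gen_sq : exists p, parab_gen (parab_gen p) <> vzero.
Proof. exists (Vec 1 0 0 0); intros H; apply (f_equal cV) in H; cbn in H; lra. Qed.

Lemma parab_gen_cube p : parab_gen (parab_gen (parab_gen p)) = vzero.
Proof. reflexivity. Qed.

Definition parabolic_rotational_symmetry (D : plane_domain) (phi : R -> R -> vec4)
    : Prop :=
  exists gamma : R -> vec4,
    forall s t, D s t -> phi s t = parab t (gamma s).

(** * The rotational surfaces *)

Definition k1 (L : R) (theta : R -> R) (s : R) : R :=
  Derive theta s + sinh (theta s) / L.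

Definition k2 (L : R) (theta : R -> R) (s : R) : R := sinh (theta s) / L.

Definition meanH (L : R) (theta : R -> R) (s : R) : R :=
  - Derive theta s / 2 - sinh (theta s) / L.

Lemma meanH_trace L theta s :
  0 < L -> meanH L theta s = - / 2 * (k1 L theta s + k2 L theta s).
Proof. intros hL; unfold meanH, k1, k2; field; lra. Qed.

(* H' / k_1 *)
Definition ratio (L : R) (theta : R -> R) (s : R) : R :=
  Derive (meanH L theta) s / k1 L theta s.

(* The equation is of third order in theta. *)
Definition profile_solution (L : R) (I : R -> Prop) (theta : R -> R)
    : Prop :=
  forall s, I s ->
    (forall n, (n <= 3)%nat -> ex_derive_n theta n s) /\
    k1 L theta s <> 0 /\
    Derive (ratio L theta) s + ratio L theta s ^ 2
      + cosh (theta s) / L * ratio L theta s + k1 L theta s ^ 2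
      + sinh (theta s) ^ 2 / L ^ 2 - 2 / L ^ 2 = 0.

Definition Vfun (L : R) (rho Y : R -> R) (s : R) : R :=
  (L ^ 2 - Y s ^ 2) / (2 * rho s).

Definition surface (L : R) (rho Y : R -> R) (s t : R) : vec4 :=
  Vec (rho s) (Vfun L rho Y s + / 2 * t ^ 2 * rho s) (Y s) (t * rho s).

(* ds^2 + rho(s)^2 dt^2 *)
Definition rot_metric (rho : R -> R) : metric := fun s _ i j =>
  match i, j with Ds, Ds => 1 | Dt, Dt => rho s ^ 2 | _, _ => 0 end.

Definition ufun (L : R) (theta : R -> R) (u0 s : R) : R :=
  u0 * exp (RInt (ratio L theta) 0 s).

Definition lambda (L : R) (theta : R -> R) (u0 s : R) : R :=
  sqrt (ufun L theta u0 s / meanH L theta s).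

(* lambda^{-2} (ds^2 + rho^2 dt^2) *)
Definition conf_metric (L : R) (theta rho : R -> R) (u0 : R) : metric :=
  fun s t i j => / (lambda L theta u0 s) ^ 2 * rot_metric rho s t i j.

(* Main.v *)
Require Import Defs.
From Stdlib Require Import Reals Lra Lia FunctionalExtensionality.
From Coquelicot Require Import Coquelicot.
Open Scope R_scope.

(** The surface carries an explicit moving frame, and every claim is read off
    its structure equations.  Let w be the unit vector field along X in the
    direction of the AdS-gradient of the null coordinate U, let m be the
    timelike unit vector (0, -Y/rho, 1, 0), orthogonal to X and w, and let
    E = X_t / rho.  The equations for rho and Y say exactly that

      T := X_s = cosh(theta) w + sinh(theta) m,

    so that (T, E) is orthonormal, and N := - sinh(theta) w - cosh(theta) m is
    a timelike unit normal.  Since w_s and m_s are explicit, one finds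

      T_s = - k1 N + X / L^2,   T_t = (cosh(theta) / L) rho E,
      E_s = 0,   E_t = rho (X / L^2 - (cosh(theta) / L) T - k2 N),
      N_s = - k1 T,             N_t = - k2 rho E,

    which gives the metric and the principal curvatures.

    In dimension two the trace of a Hessian only scales under a conformal
    change of the metric ([warped_trace]).  For the metric f (ds^2 + rho^2 dt^2)
    with f = lambda^-2 = H / u the tension field is therefore
    (2 H / f) N = 2 u N.  The curvature of AdS_3(L) is constant, so the bitension
    field of X is, up to the factor 2 / f,

      (u'' + (cosh(theta) / L) u' + (k1^2 + k2^2 - 2 / L^2) u) N
      + (- 2 k1 u' - u (k1' + (cosh(theta) / L) (k1 - k2))) T.

    The Codazzi equation k1' + (cosh(theta) / L) (k1 - k2) = - 2 H' makes the
    tangential part vanish because u' / u = H' / k1, and with this value of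
    u' / u the normal part is u times the differential equation satisfied by
    theta.  This is [surface_biharmonic_at].

    Two further points need an argument.  The bitension field is to vanish in
    every pseudo-orthonormal frame: an orthonormal frame resolves the inverse
    metric, and the derivatives of the frame cancel, so the rough Laplacian
    is a trace of coordinate Hessians ([rough_laplacian_trace]).  And theta is
    only assumed three times differentiable: solving the equation for its
    highest derivative shows by induction that it is smooth
    ([profile_smooth]), and then so are rho, Y and u, as solutions of linear
    equations. *)

(** * Smoothness in one variable *)

(** [auto_derive] produces eta-expanded arguments of [Derive], which hide the
    equality of the atoms from [ring]. *)
Ltac eta_derive :=
  repeat match goal with
  | |- context [Derive (fun x => ?f x)] =>
      progress change (Derive (fun x => f x)) with (Derive f)
  end.

(** Existence of derivatives up to order n, in a recursive form in which the
    closure properties follow by induction on n from the rules of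
    differentiation. *)
Fixpoint diff_on (n : nat) (I : R -> Prop) (f : R -> R) : Prop :=
  match n with
  | O => True
  | S m => (forall s, I s -> ex_derive f s) /\ diff_on m I (Derive f)
  end.

Definition smooth_on (I : R -> Prop) (f : R -> R) : Prop :=
  forall n, diff_on n I f.

Lemma diff_on_S n I f : diff_on (S n) I f -> diff_on n I f.
Proof.
  revert f; induction n as [|n IH]; intros f H; [exact Logic.I|].
  destruct H as [H1 H2]; split; [exact H1 | exact (IH _ H2)].
Qed.

Lemma diff_on_subset n (I I' : R -> Prop) f :
  (forall s, I' s -> I s) -> diff_on n I f -> diff_on n I' f.
Proof.
  revert f; induction n as [|n IH]; intros f HI H; [exact Logic.I|].
  destruct H as [H1 H2]; split; auto.
Qed.

Lemma open_eq_locally (I : R -> Prop) (f g : R -> R) s :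
  open I -> (forall x, I x -> f x = g x) -> I s ->
  locally s (fun x => f x = g x).
Proof.
  intros HI Hfg Hs; generalize (HI s Hs); apply filter_imp; exact Hfg.
Qed.

Lemma diff_on_ext n I f g :
  open I -> (forall s, I s -> f s = g s) -> diff_on n I f -> diff_on n I g.
Proof.
  intros HI; revert f g; induction n as [|n IH]; intros f g Hfg H;
    [exact Logic.I|].
  destruct H as [H1 H2]; split.
  - intros s Hs; apply (ex_derive_ext_loc f); [|exact (H1 s Hs)].
    now apply open_eq_locally with I.
  - apply (IH (Derive f)); [|exact H2]; intros s Hs.
    apply Derive_ext_loc; now apply open_eq_locally with I.
Qed.

Lemma diff_on_of_derive n I f f' :
  open I -> (forall s, I s -> is_derive f s (f' s)) ->
  diff_on n I f' -> diff_on (S n) I f.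
Proof.
  intros HI Hf H; split.
  - intros s Hs; exists (f' s); exact (Hf s Hs).
  - apply (diff_on_ext n I f'); trivial.
    intros s Hs; symmetry; apply is_derive_unique; exact (Hf s Hs).
Qed.

Lemma diff_on_const n I c : diff_on n I (fun _ => c).
Proof.
  revert c; induction n as [|n IH]; intros c; [exact Logic.I|split].
  - intros s _; apply ex_derive_const.
  - cut (diff_on n I (fun _ => 0)); [|apply IH].
    replace (Derive (fun _ : R => c)) with (fun _ : R => 0); trivial.
    apply functional_extensionality; intros s.
    symmetry; apply Derive_const.
Qed.

Lemma diff_on_plus n I f g :
  open I -> diff_on n I f -> diff_on n I g ->
  diff_on n I (fun s => f s + g s).
Proof.
  intros HI; revert f g; induction n as [|n IH]; intros f g Hf Hg;
    [exact Logic.I|].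
  destruct Hf as [Hf Hf'], Hg as [Hg Hg'].
  apply diff_on_of_derive with (fun s => Derive f s + Derive g s); auto.
  intros s Hs; apply (is_derive_plus (V := R_NormedModule));
    apply Derive_correct; auto.
Qed.

Lemma diff_on_mult n I f g :
  open I -> diff_on n I f -> diff_on n I g ->
  diff_on n I (fun s => f s * g s).
Proof.
  intros HI; revert f g; induction n as [|n IH]; intros f g Hf Hg;
    [exact Logic.I|].
  pose proof (diff_on_S _ _ _ Hf) as Hf0; pose proof (diff_on_S _ _ _ Hg) as Hg0.
  destruct Hf as [Hf Hf'], Hg as [Hg Hg'].
  apply diff_on_of_derive with (fun s => Derive f s * g s + f s * Derive g s);
    [assumption | | apply diff_on_plus; auto].
  intros s Hs; apply (is_derive_mult (K := R_AbsRing));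
    [apply Derive_correct; auto .. | exact Rmult_comm].
Qed.

Lemma diff_on_opp n I f :
  open I -> diff_on n I f -> diff_on n I (fun s => - f s).
Proof.
  intros HI Hf; apply diff_on_ext with (fun s => -1 * f s); trivial.
  - intros s _; ring.
  - apply diff_on_mult; trivial; apply diff_on_const.
Qed.

Lemma diff_on_minus n I f g :
  open I -> diff_on n I f -> diff_on n I g ->
  diff_on n I (fun s => f s - g s).
Proof. intros HI Hf Hg; apply diff_on_plus; trivial; now apply diff_on_opp. Qed.

Lemma diff_on_pow n I f k :
  open I -> diff_on n I f -> diff_on n I (fun s => f s ^ k).
Proof.
  intros HI Hf; induction k as [|k IH]; cbn [pow];
    [apply diff_on_const | now apply diff_on_mult].
Qed.

Lemma diff_on_inv n I f :
  open I -> (forall s, I s -> f s <> 0) ->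
  diff_on n I f -> diff_on n I (fun s => / f s).
Proof.
  intros HI H0; induction n as [|n IH]; intros Hf; [exact Logic.I|].
  pose proof (IH (diff_on_S _ _ _ Hf)) as Hi; destruct Hf as [Hf Hf'].
  apply diff_on_of_derive with (fun s => - Derive f s * (/ f s) ^ 2); trivial.
  - intros s Hs.
    replace (- Derive f s * (/ f s) ^ 2) with (- Derive f s / f s ^ 2)
      by (field; auto).
    apply is_derive_inv; [apply Derive_correct|]; auto.
  - apply diff_on_mult; [assumption | apply diff_on_opp | apply diff_on_pow];
      assumption.
Qed.

Lemma diff_on_div n I f g :
  open I -> (forall s, I s -> g s <> 0) ->
  diff_on n I f -> diff_on n I g -> diff_on n I (fun s => f s / g s).
Proof. intros HI H0 Hf Hg; apply diff_on_mult; trivial; now apply diff_on_inv. Qed.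

(** Each of the two functions is, up to a factor, the derivative of the other,
    so the inductions have to run together. *)
Lemma diff_on_hyperbolic n I f :
  open I -> diff_on n I f ->
  diff_on n I (fun s => cosh (f s)) /\ diff_on n I (fun s => sinh (f s)).
Proof.
  intros HI; induction n as [|n IH]; intros Hf; [split; exact Logic.I|].
  destruct (IH (diff_on_S _ _ _ Hf)) as [Hc Hs]; destruct Hf as [Hf Hf'].
  split.
  - apply diff_on_of_derive with (fun s => Derive f s * sinh (f s));
      [assumption | | now apply diff_on_mult].
    intros s Is; auto_derive; [auto | eta_derive; ring].
  - apply diff_on_of_derive with (fun s => Derive f s * cosh (f s));
      [assumption | | now apply diff_on_mult].
    intros s Is; auto_derive; [auto | eta_derive; ring].
Qed.

Lemma diff_on_cosh n I f :
  open I -> diff_on n I f -> diff_on n I (fun s => cosh (f s)).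
Proof. intros HI Hf; exact (proj1 (diff_on_hyperbolic n I f HI Hf)). Qed.

Lemma diff_on_sinh n I f :
  open I -> diff_on n I f -> diff_on n I (fun s => sinh (f s)).
Proof. intros HI Hf; exact (proj2 (diff_on_hyperbolic n I f HI Hf)). Qed.

Lemma diff_on_sqrt n I f :
  open I -> (forall s, I s -> 0 < f s) ->
  diff_on n I f -> diff_on n I (fun s => sqrt (f s)).
Proof.
  intros HI H0; induction n as [|n IH]; intros Hf; [exact Logic.I|].
  pose proof (IH (diff_on_S _ _ _ Hf)) as Hq; destruct Hf as [Hf Hf'].
  apply diff_on_of_derive with (fun s => Derive f s / (2 * sqrt (f s)));
    trivial.
  - intros s Hs; apply is_derive_sqrt; [apply Derive_correct|]; auto.
  - apply diff_on_div; trivial.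
    + intros s Hs; pose proof (sqrt_lt_R0 _ (H0 s Hs)); lra.
    + apply diff_on_mult; trivial; apply diff_on_const.
Qed.

(** Bootstrapping: the right-hand side is as often differentiable as f, hence f
    is so once more. *)
Lemma smooth_on_linear_ode I f a b :
  open I -> smooth_on I a -> smooth_on I b ->
  (forall s, I s -> is_derive f s (a s * f s + b s)) -> smooth_on I f.
Proof.
  intros HI Ha Hb Hf n; induction n as [|n IH]; [exact Logic.I|].
  apply diff_on_of_derive with (fun s => a s * f s + b s); trivial.
  apply diff_on_plus; [assumption | | apply Hb].
  apply diff_on_mult; [assumption | apply Ha | assumption].
Qed.

(** The hyperbolic functions come before sums and products, since these would
    unify with the unfolded definition of [sinh].  Division is treated as the
    multiplication by an inverse that is constant or known to be smooth. *)
Ltac diff_on_tac :=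
  repeat first
    [ assumption
    | match goal with H : smooth_on ?I _ |- diff_on _ ?I _ => exact (H _) end
    | apply diff_on_const | apply diff_on_cosh
    | apply diff_on_sinh | apply diff_on_plus | apply diff_on_minus
    | apply diff_on_mult | apply diff_on_opp | apply diff_on_pow ].

(** * The profile equation and the regularity of its solutions *)

Lemma ratio_eq_of_profile L I theta s :
  profile_solution L I theta -> I s ->
  Derive (meanH L theta) s = ratio L theta s * k1 L theta s.
Proof.
  intros H Hs; destruct (H s Hs) as (_ & H1 & _).
  unfold ratio; field; exact H1.
Qed.

Lemma is_derive_k1 L theta s :
  ex_derive theta s -> ex_derive (Derive theta) s ->
  is_derive (k1 L theta) s
    (Derive (Derive theta) s + Derive theta s * cosh (theta s) / L).
Proof. intros H1 H2; unfold k1; auto_derive; [tauto | eta_derive; unfold Rdiv; ring]. Qed.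

Lemma is_derive_meanH L theta s :
  ex_derive theta s -> ex_derive (Derive theta) s ->
  is_derive (meanH L theta) s
    (- Derive (Derive theta) s / 2 - Derive theta s * cosh (theta s) / L).
Proof.
  intros H1 H2; unfold meanH; auto_derive;
    [tauto | eta_derive; unfold Rdiv; generalize (/ L); intros; field].
Qed.

Lemma profile_ex_derive L I theta : profile_solution L I theta ->
  forall s, I s -> ex_derive theta s /\ ex_derive (Derive theta) s /\
    ex_derive (Derive (Derive theta)) s.
Proof.
  intros H s Hs; destruct (H s Hs) as (Hd & _).
  split; [exact (Hd 1%nat ltac:(lia))|].
  split; [exact (Hd 2%nat ltac:(lia)) | exact (Hd 3%nat ltac:(lia))].
Qed.

(** If theta is n + 2 times differentiable, then the ratio H' / k1 is n times
    differentiable, and the equation expresses its derivative through functions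
    that are at least n times differentiable.  So H' / k1 gains one order, hence
    H', hence theta'', and theta is n + 3 times differentiable. *)
Lemma profile_smooth L I theta :
  open I -> profile_solution L I theta -> smooth_on I theta.
Proof.
  intros HI Hp.
  pose proof (profile_ex_derive L I theta Hp) as Hd.
  assert (Hk : forall s, I s -> k1 L theta s <> 0)
    by (intros s Hs; apply (Hp s Hs)).
  set (H' := fun s => - Derive (Derive theta) s / 2
                      - Derive theta s * cosh (theta s) / L).
  assert (HH : forall s, I s -> Derive (meanH L theta) s = H' s).
  { intros s Hs; destruct (Hd s Hs) as (d1 & d2 & _).
    apply is_derive_unique, is_derive_meanH; trivial. }
  assert (Hr : forall s, I s -> H' s / k1 L theta s = ratio L theta s).
  { intros s Hs; unfold ratio; now rewrite HH. }
  assert (Step : forall n, diff_on (S (S n)) I theta ->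
                           diff_on (S (S (S n))) I theta).
  { intros n H2.
    pose proof (diff_on_S _ _ _ H2) as H1; pose proof (diff_on_S _ _ _ H1) as H0.
    assert (T1 : diff_on (S n) I (Derive theta)) by apply H2.
    assert (T0 : diff_on n I (Derive theta)) by apply H1.
    assert (T2 : diff_on n I (Derive (Derive theta))) by apply T1.
    assert (K0 : diff_on n I (k1 L theta)) by (unfold k1, Rdiv; diff_on_tac).
    assert (R0 : diff_on n I (ratio L theta)).
    { apply diff_on_ext with (fun s => H' s / k1 L theta s); trivial.
      apply diff_on_div; trivial; unfold H', Rdiv; diff_on_tac. }
    assert (R1 : diff_on (S n) I (ratio L theta)).
    { apply diff_on_of_derive with (fun s => 2 / L ^ 2
        - (ratio L theta s ^ 2 + cosh (theta s) / L * ratio L theta s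
           + k1 L theta s ^ 2 + sinh (theta s) ^ 2 / L ^ 2)); trivial.
      - intros s Hs; destruct (Hp s Hs) as (_ & _ & He).
        destruct (Hd s Hs) as (d1 & d2 & d3).
        replace (2 / L ^ 2 - _) with (Derive (ratio L theta) s) by lra.
        apply Derive_correct.
        apply ex_derive_ext_loc with (fun x => H' x / k1 L theta x).
        + now apply open_eq_locally with I.
        + pose proof (is_derive_k1 L theta s d1 d2) as dk.
          pose proof (Hk s Hs) as k0.
          apply ex_derive_div;
            [unfold H'; auto_derive; tauto | eexists; apply dk | exact k0].
      - unfold Rdiv; diff_on_tac. }
    assert (T2' : diff_on (S n) I (Derive (Derive theta))).
    { apply diff_on_ext with
        (fun s => -2 * (ratio L theta s * k1 L theta s
                        + Derive theta s * cosh (theta s) * / L)); trivial.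
      - intros s Hs.
        assert (E : ratio L theta s * k1 L theta s = H' s).
        { rewrite <- Hr by assumption; field; now apply Hk. }
        rewrite E; unfold H', Rdiv; generalize (/ L); intros; field.
      - assert (diff_on (S n) I (k1 L theta)) by (unfold k1, Rdiv; diff_on_tac).
        diff_on_tac. }
    split; [intros s Hs; apply (Hd s Hs)|].
    split; [intros s Hs; apply (Hd s Hs) | exact T2']. }
  assert (All : forall n, diff_on (S (S n)) I theta).
  { induction n as [|n IH]; [|now apply Step].
    split; [intros s Hs; apply (Hd s Hs)|].
    split; [intros s Hs; apply (Hd s Hs) | exact Logic.I]. }
  intros n; now apply diff_on_S, diff_on_S.
Qed.

(** * Smoothness in the plane *)

Lemma open_domain_rect (I J : R -> Prop) :
  open I -> open J -> open_domain (rect I J).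
Proof.
  intros HI HJ s t [Hs Ht].
  destruct (HI s Hs) as [d1 H1], (HJ t Ht) as [d2 H2].
  exists (mkposreal (Rmin d1 d2) (Rmin_pos _ _ (cond_pos d1) (cond_pos d2))).
  cbn; intros u v Hu Hv; split.
  - apply H1; apply Rlt_le_trans with (1 := Hu), Rmin_l.
  - apply H2; apply Rlt_le_trans with (1 := Hv), Rmin_r.
Qed.

Lemma pd_ext_on D f g i s t :
  open_domain D -> (forall x y, D x y -> f x y = g x y) -> D s t ->
  pd i f s t = pd i g s t.
Proof.
  intros HD Hfg Hst; pose proof (HD s t Hst) as Hl; destruct i; cbn.
  - apply Derive_ext_loc.
    generalize (locally_2d_1d_const_y _ _ _ Hl); apply filter_imp; auto.
  - apply Derive_ext_loc.
    generalize (locally_2d_1d_const_x _ _ _ Hl); apply filter_imp; auto.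
Qed.

Lemma Ck_ext k D f g :
  open_domain D -> (forall x y, D x y -> f x y = g x y) ->
  Ck k D f -> Ck k D g.
Proof.
  intros HD; revert f g; induction k as [|k IH]; intros f g Hfg [Hc H].
  all: assert (Hc' : forall s t, D s t -> continuity_2d_pt g s t).
  1,3: intros s t Hst; apply continuity_2d_pt_ext_loc with f; auto;
       apply locally_2d_impl with (2 := HD s t Hst);
       apply locally_2d_forall; auto.
  - split; trivial.
  - destruct H as [He Hp]; split; [assumption|]; split.
    + intros s t Hst; destruct (He s t Hst) as [e1 e2].
      pose proof (HD s t Hst) as Hl; split.
      * apply ex_derive_ext_loc with (2 := e1).
        generalize (locally_2d_1d_const_y _ _ _ Hl); apply filter_imp; auto.
      * apply ex_derive_ext_loc with (2 := e2).
        generalize (locally_2d_1d_const_x _ _ _ Hl); apply filter_imp; auto.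
    + intros i; apply IH with (pd i f); auto.
      intros x y Hxy; now apply pd_ext_on with D.
Qed.

Lemma Ck_S k D f : Ck (S k) D f -> Ck k D f.
Proof.
  revert f; induction k as [|k IH]; intros f [Hc [He Hp]]; split; auto.
Qed.

Lemma Ck_const k D c : Ck k D (fun _ _ => c).
Proof.
  revert c; induction k as [|k IH]; intros c; split; auto;
    try (intros; apply continuity_2d_pt_const).
  split.
  - intros; split; apply ex_derive_const.
  - intros i; replace (pd i (fun _ _ => c)) with (fun _ _ : R => 0); auto.
    apply functional_extensionality; intros s.
    apply functional_extensionality; intros t.
    destruct i; cbn; symmetry; apply Derive_const.
Qed.

Lemma Ck_snd k D : Ck k D (fun _ t => t).
Proof.
  destruct k; split; auto; try (intros; apply continuity_2d_pt_id2).
  split.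
  - intros; split; [apply ex_derive_const | apply ex_derive_id].
  - assert (E : forall i, pd i (fun _ t : R => t) = fun _ _ => delta i Dt).
    { intros i; apply functional_extensionality; intros s.
      apply functional_extensionality; intros t.
      destruct i; cbn; [apply Derive_const | apply Derive_id]. }
    intros i; rewrite E; apply Ck_const.
Qed.

(** The extra order on the left pays for the continuity of the k-th
    derivative. *)
Lemma Ck_fst k (I J : R -> Prop) f :
  diff_on (S k) I f -> Ck k (rect I J) (fun s _ => f s).
Proof.
  revert f; induction k as [|k IH]; intros f [Hd H]; split.
  1,3: intros s t [Hs _];
    apply (continuity_1d_2d_pt_comp f (fun u _ => u));
    [ apply continuity_pt_filterlim, (ex_derive_continuous f), Hd, Hs
    | apply continuity_2d_pt_id1 ].
  - exact Logic.I.
  - split.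
    + intros s t [Hs _]; split; [now apply Hd | apply ex_derive_const].
    + intros [|].
      * exact (IH (Derive f) H).
      * replace (pd Dt (fun s _ => f s)) with (fun _ _ : R => 0);
          [apply Ck_const|].
        apply functional_extensionality; intros s.
        apply functional_extensionality; intros t.
        cbn; symmetry; apply Derive_const.
Qed.

Lemma Ck_plus k D f g :
  open_domain D -> Ck k D f -> Ck k D g -> Ck k D (fun s t => f s t + g s t).
Proof.
  intros HD; revert f g; induction k as [|k IH]; intros f g [Fc F] [Gc G]; split;
    try (intros; apply continuity_2d_pt_plus; auto); auto.
  destruct F as [Fe Fp], G as [Ge Gp]; split.
  - intros s t Hst; destruct (Fe s t Hst), (Ge s t Hst); split;
      now apply (ex_derive_plus (V := R_NormedModule)).
  - intros i; apply Ck_ext with (fun s t => pd i f s t + pd i g s t); auto.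
    intros s t Hst; destruct (Fe s t Hst), (Ge s t Hst).
    destruct i; cbn; symmetry; now apply Derive_plus.
Qed.

Lemma Ck_mult k D f g :
  open_domain D -> Ck k D f -> Ck k D g -> Ck k D (fun s t => f s t * g s t).
Proof.
  intros HD; revert f g; induction k as [|k IH]; intros f g F0 G0.
  - destruct F0, G0; split; auto; intros; apply continuity_2d_pt_mult; auto.
  - pose proof (Ck_S _ _ _ F0) as F1; pose proof (Ck_S _ _ _ G0) as G1.
    destruct F0 as [Fc [Fe Fp]], G0 as [Gc [Ge Gp]].
    split; [intros; apply continuity_2d_pt_mult; auto|]; split.
    + intros s t Hst; destruct (Fe s t Hst), (Ge s t Hst).
      split; [apply (ex_derive_mult (fun x => f x t) (fun x => g x t))
             | apply (ex_derive_mult (f s) (g s))]; assumption.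
    + intros i; apply Ck_ext with
        (fun s t => pd i f s t * g s t + f s t * pd i g s t); auto.
      * intros s t Hst; destruct (Fe s t Hst), (Ge s t Hst).
        destruct i; cbn; symmetry;
          [apply (Derive_mult (fun x => f x t) (fun x => g x t))
          | apply (Derive_mult (f s) (g s))]; assumption.
      * apply Ck_plus; auto.
Qed.

Lemma smooth_plus D f g :
  open_domain D -> smooth D f -> smooth D g -> smooth D (fun s t => f s t + g s t).
Proof. intros HD Hf Hg k; apply Ck_plus; auto. Qed.

Lemma smooth_mult D f g :
  open_domain D -> smooth D f -> smooth D g -> smooth D (fun s t => f s t * g s t).
Proof. intros HD Hf Hg k; apply Ck_mult; auto. Qed.

Lemma smooth_const D c : smooth D (fun _ _ => c).
Proof. intros k; apply Ck_const. Qed.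

Lemma smooth_snd D : smooth D (fun _ t => t).
Proof. intros k; apply Ck_snd. Qed.

Lemma smooth_fst I J f : smooth_on I f -> smooth (rect I J) (fun s _ => f s).
Proof. intros Hf k; apply Ck_fst, Hf. Qed.

(** * Vector calculus in R^{2,2} *)

Lemma vec4_eq x y :
  cU x = cU y -> cV x = cV y -> cY x = cY y -> cZ x = cZ y -> x = y.
Proof. destruct x, y; cbn; intros; subst; reflexivity. Qed.

(** Reducing under the projections with [cbn] keeps the terms linear in size;
    unfolding the operations first would copy every subterm four times per
    level. *)
Ltac vec :=
  apply vec4_eq; cbn [cU cV cY cZ vsum2 vsub vopp vadd vscal vzero].

Lemma sprod_add_l x y z : sprod (vadd x y) z = sprod x z + sprod y z.
Proof. unfold sprod, vadd; cbn; ring. Qed.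
Lemma sprod_add_r x y z : sprod z (vadd x y) = sprod z x + sprod z y.
Proof. unfold sprod, vadd; cbn; ring. Qed.
Lemma sprod_scal_l a x z : sprod (vscal a x) z = a * sprod x z.
Proof. unfold sprod, vscal; cbn; ring. Qed.
Lemma sprod_scal_r a x z : sprod z (vscal a x) = a * sprod z x.
Proof. unfold sprod, vscal; cbn; ring. Qed.
Lemma sprod_comm x y : sprod x y = sprod y x.
Proof. unfold sprod; ring. Qed.

Ltac sprod_lin :=
  unfold vsum2, vsub, vopp;
  repeat rewrite ?sprod_add_l, ?sprod_add_r, ?sprod_scal_l, ?sprod_scal_r.

Lemma proj_add L p x y : proj L p (vadd x y) = vadd (proj L p x) (proj L p y).
Proof. unfold proj; sprod_lin; vec; unfold Rdiv; ring. Qed.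
Lemma proj_scal L p a x : proj L p (vscal a x) = vscal a (proj L p x).
Proof. unfold proj; sprod_lin; vec; unfold Rdiv; ring. Qed.
Lemma proj_tangent L p x : sprod x p = 0 -> proj L p x = x.
Proof. intros H; unfold proj; rewrite H; vec; unfold Rdiv; ring. Qed.
Lemma proj_self L p : L <> 0 -> AdS L p -> proj L p p = vzero.
Proof. unfold AdS; intros HL H; unfold proj; rewrite H; vec; field; trivial. Qed.
Lemma sprod_proj L p x : L <> 0 -> AdS L p -> sprod (proj L p x) p = 0.
Proof. unfold AdS; intros HL H; unfold proj; sprod_lin; rewrite H; field; trivial. Qed.

(** Componentwise differentiability of curves in R^{2,2}, as a relation, so that
    derivatives are computed by composing rules. *)
Definition vder (f : R -> vec4) (r : R) (v : vec4) : Prop :=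
  is_derive (fun x => cU (f x)) r (cU v) /\
  is_derive (fun x => cV (f x)) r (cV v) /\
  is_derive (fun x => cY (f x)) r (cY v) /\
  is_derive (fun x => cZ (f x)) r (cZ v).

Ltac vsplit := split; [|split; [|split]].

Lemma is_derive_eq (f : R -> R) (x a b : R) : is_derive f x a -> a = b -> is_derive f x b.
Proof. intros H <-; exact H. Qed.

Lemma vder_eq f r v w : vder f r v -> v = w -> vder f r w.
Proof. intros H <-; exact H. Qed.

Lemma vder_const c r : vder (fun _ => c) r vzero.
Proof. vsplit; apply (is_derive_const (V := R_NormedModule)). Qed.

Lemma vder_add f g r v w :
  vder f r v -> vder g r w -> vder (fun x => vadd (f x) (g x)) r (vadd v w).
Proof.
  intros (f1 & f2 & f3 & f4) (g1 & g2 & g3 & g4).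
  vsplit; now apply (is_derive_plus (V := R_NormedModule)).
Qed.

Lemma is_derive_Rmult (f g : R -> R) r a b :
  is_derive f r a -> is_derive g r b ->
  is_derive (fun x => f x * g x) r (a * g r + f r * b).
Proof.
  intros Hf Hg; apply (is_derive_mult (K := R_AbsRing)); trivial;
    exact Rmult_comm.
Qed.

Lemma vder_scal a f r a' v :
  is_derive a r a' -> vder f r v ->
  vder (fun x => vscal (a x) (f x)) r (vadd (vscal a' (f r)) (vscal (a r) v)).
Proof.
  intros Ha (f1 & f2 & f3 & f4).
  vsplit; cbn; now apply is_derive_Rmult.
Qed.

Lemma vder_scal_const a f r v :
  vder f r v -> vder (fun x => vscal a (f x)) r (vscal a v).
Proof.
  intros H.
  apply vder_eq with (vadd (vscal 0 (f r)) (vscal a v)); [|vec; ring].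
  apply (vder_scal (fun _ => a)); trivial.
  apply (is_derive_const (V := R_NormedModule)).
Qed.

Lemma is_derive_sprod f g r v w :
  vder f r v -> vder g r w ->
  is_derive (fun x => sprod (f x) (g x)) r (sprod v (g r) + sprod (f r) w).
Proof.
  intros (f1 & f2 & f3 & f4) (g1 & g2 & g3 & g4); unfold sprod.
  apply is_derive_eq with
    (- ((cU v * cV (g r) + cU (f r) * cV w) + (cV v * cU (g r) + cV (f r) * cU w))
     - (cY v * cY (g r) + cY (f r) * cY w) + (cZ v * cZ (g r) + cZ (f r) * cZ w));
    [|ring].
  apply (is_derive_plus (V := R_NormedModule)); [|now apply is_derive_Rmult].
  apply (is_derive_minus (V := R_NormedModule)); [|now apply is_derive_Rmult].
  apply (is_derive_opp (V := R_NormedModule)).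
  apply (is_derive_plus (V := R_NormedModule)); now apply is_derive_Rmult.
Qed.

Lemma is_derive_Rdiv_const (f : R -> R) (c r a : R) :
  is_derive f r a -> is_derive (fun x => f x / c) r (a / c).
Proof.
  intros H; unfold Rdiv.
  apply is_derive_eq with (a * / c + f r * 0); [|ring].
  apply (is_derive_Rmult f (fun _ => / c)); trivial.
  apply (is_derive_const (V := R_NormedModule)).
Qed.

Lemma vder_line p x r : vder (fun y => vadd p (vscal y x)) r x.
Proof.
  apply vder_eq with (vadd vzero (vadd (vscal 1 x) (vscal r vzero))); [|vec; ring].
  apply vder_add; [apply vder_const|].
  apply (vder_scal (fun y => y) (fun _ => x));
    [apply (is_derive_id (K := R_AbsRing)) | apply vder_const].
Qed.

Lemma dirD_unique F p x v :
  vder (fun r => F (vadd p (vscal r x))) 0 v -> dirD F p x = v.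
Proof.
  intros (H1 & H2 & H3 & H4); unfold dirD.
  apply vec4_eq; cbn; now apply is_derive_unique.
Qed.

Lemma line_0 p x : vadd p (vscal 0 x) = p.
Proof. vec; ring. Qed.

Lemma vder_proj L f g r v w :
  vder f r v -> vder g r w ->
  vder (fun x => proj L (f x) (g x)) r
    (vadd w (vadd (vscal ((sprod w (f r) + sprod (g r) v) / L ^ 2) (f r))
                  (vscal (sprod (g r) (f r) / L ^ 2) v))).
Proof.
  intros Hf Hg; unfold proj; apply vder_add; trivial.
  apply (vder_scal (fun x => sprod (g x) (f x) / L ^ 2)); trivial.
  apply is_derive_Rdiv_const; now apply is_derive_sprod.
Qed.

(** * The curvature tensor of AdS_3(L) *)

Lemma dirD_extend L z q v :
  dirD (extend L z) q v
  = vadd (vscal (sprod z v / L ^ 2) q) (vscal (sprod z q / L ^ 2) v).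
Proof.
  apply dirD_unique; unfold extend.
  eapply vder_eq.
  - apply (vder_proj L _ (fun _ => z)); [apply vder_line | apply vder_const].
  - cbv beta; rewrite line_0.
    unfold sprod; vec; unfold Rdiv; ring.
Qed.

Lemma nablaN_extend L y z q :
  nablaN L (extend L y) (extend L z) q
  = proj L q (vadd (vscal (sprod z (proj L q y) / L ^ 2) q)
                   (vscal (sprod z q / L ^ 2) (proj L q y))).
Proof. unfold nablaN; now rewrite dirD_extend. Qed.

(** At p the first covariant derivative of the field extending z vanishes,
    because z is tangent at p.  Of the terms of its differential along x, those
    tangent to AdS_3(L) in the direction of x cancel against the derivative
    of the projection, and those along p are projected away. *)
Lemma nablaN_nablaN_extend L p x y z :
  L <> 0 -> AdS L p ->
  sprod x p = 0 -> sprod y p = 0 -> sprod z p = 0 ->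
  nablaN L (extend L x) (nablaN L (extend L y) (extend L z)) p
  = vscal (sprod z x / L ^ 2) y.
Proof.
  unfold AdS; intros HL Hp Hx Hy Hz.
  rewrite (functional_extensionality _ _ (nablaN_extend L y z)).
  unfold nablaN, extend; rewrite (proj_tangent L p x) by trivial.
  set (q := fun r => vadd p (vscal r x)).
  assert (Hq0 : q 0 = p) by apply line_0.
  assert (Hq : vder q 0 x) by apply vder_line.
  pose proof (vder_proj L q (fun _ => y) 0 x vzero Hq (vder_const y 0)) as HY.
  rewrite Hq0, Hy in HY.
  pose proof (is_derive_Rdiv_const _ (L ^ 2) _ _
    (is_derive_sprod (fun _ => z) _ _ _ _ (vder_const z 0) HY)) as Hc1.
  pose proof (is_derive_Rdiv_const _ (L ^ 2) _ _
    (is_derive_sprod (fun _ => z) _ _ _ _ (vder_const z 0) Hq)) as Hc2.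
  pose proof (vder_proj L q _ 0 x _ Hq
    (vder_add _ _ _ _ _ (vder_scal _ _ _ _ _ Hc1 Hq)
       (vder_scal _ _ _ _ _ Hc2 HY))) as HF.
  cbv beta in HF; rewrite Hq0 in HF.
  match type of HF with vder _ _ ?v => rewrite (dirD_unique _ p x v HF) end.
  rewrite (proj_tangent L p y) by trivial.
  rewrite !proj_add, !proj_scal, !proj_add, !proj_scal.
  rewrite (proj_self L p), (proj_tangent L p y), (proj_tangent L p x) by trivial.
  sprod_lin; rewrite ?(sprod_comm p x), ?Hx, ?Hy, ?Hz, ?Hp.
  assert (Hv : forall w, sprod vzero w = 0) by (intros w; unfold sprod; cbn; ring).
  rewrite ?Hv, ?(sprod_comm _ vzero), ?Hv.
  vec; field; trivial.
Qed.

(** AdS_3(L) has constant curvature -1/L^2.  The bracket of the two extended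
    fields vanishes at p by the symmetry of the scalar product. *)
Lemma RN_value L p x y z :
  L <> 0 -> AdS L p ->
  sprod x p = 0 -> sprod y p = 0 -> sprod z p = 0 ->
  RN L p x y z
  = vscal (/ L ^ 2) (vsub (vscal (sprod z x) y) (vscal (sprod z y) x)).
Proof.
  intros HL Hp Hx Hy Hz; unfold RN, curvN.
  rewrite !nablaN_nablaN_extend by trivial.
  assert (Hb : bracketN (extend L x) (extend L y) p = vzero).
  { unfold bracketN; rewrite !dirD_extend; unfold extend.
    rewrite !proj_tangent by trivial.
    rewrite Hx, Hy, (sprod_comm y x); vec; unfold Rdiv; ring. }
  unfold nablaN; rewrite Hb, dirD_extend, Hz.
  unfold proj, sprod; vec; unfold Rdiv; ring.
Qed.

(** * Frame independence of the rough Laplacian *)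

Definition is_vpd (i : axis) (sig : R -> R -> vec4) (s t : R) (v : vec4) : Prop :=
  match i with
  | Ds => vder (fun x => sig x t) s v
  | Dt => vder (fun y => sig s y) t v
  end.

Definition is_pd (i : axis) (f : R -> R -> R) (s t a : R) : Prop :=
  match i with
  | Ds => is_derive (fun x => f x t) s a
  | Dt => is_derive (fun y => f s y) t a
  end.

Lemma vpd_unique i sig s t v : is_vpd i sig s t v -> vpd i sig s t = v.
Proof.
  intros H; apply vec4_eq; destruct i; cbn;
    apply is_derive_unique; apply H.
Qed.

Lemma is_vpd_eq i sig s t v w : is_vpd i sig s t v -> v = w -> is_vpd i sig s t w.
Proof. intros H <-; exact H. Qed.

Lemma is_vpd_add i f g s t v w :
  is_vpd i f s t v -> is_vpd i g s t w ->
  is_vpd i (fun x y => vadd (f x y) (g x y)) s t (vadd v w).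
Proof. destruct i; cbn; apply vder_add. Qed.

Lemma is_vpd_scal i a f s t a' v :
  is_pd i a s t a' -> is_vpd i f s t v ->
  is_vpd i (fun x y => vscal (a x y) (f x y)) s t
    (vadd (vscal a' (f s t)) (vscal (a s t) v)).
Proof.
  destruct i; cbn; intros Ha Hf.
  - now apply (vder_scal (fun x => a x t) (fun x => f x t)).
  - now apply (vder_scal (a s) (f s)).
Qed.

Lemma vder_ext_loc (f g : R -> vec4) (r : R) v :
  locally r (fun x => f x = g x) -> vder f r v -> vder g r v.
Proof.
  intros He (h1 & h2 & h3 & h4); vsplit;
    (eapply is_derive_ext_loc; [|eassumption]); revert He;
    apply filter_imp; intros x Hx; now rewrite Hx.
Qed.

Lemma is_vpd_ext D i f g s t v :
  open_domain D -> D s t -> (forall x y, D x y -> f x y = g x y) ->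
  is_vpd i f s t v -> is_vpd i g s t v.
Proof.
  intros HD Hst Hfg; pose proof (HD s t Hst) as Hl; destruct i;
    apply vder_ext_loc.
  - generalize (locally_2d_1d_const_y _ _ _ Hl); apply filter_imp; auto.
  - generalize (locally_2d_1d_const_x _ _ _ Hl); apply filter_imp; auto.
Qed.

Lemma nablaP_coord L phi k sig s t :
  nablaP L phi (coord k) sig s t = proj L (phi s t) (vpd k sig s t).
Proof.
  unfold nablaP; f_equal; unfold ddir, coord, delta.
  destruct k; vec; ring.
Qed.

Lemma nablaP_lin L phi v sig s t :
  nablaP L phi v sig s t
  = vsum2 (fun k => vscal (v k) (nablaP L phi (coord k) sig s t)).
Proof.
  unfold vsum2; rewrite !nablaP_coord.
  unfold nablaP, ddir, vsum2; now rewrite proj_add, !proj_scal.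
Qed.

(** With the frame as rows of a matrix F and G the metric, orthonormality says
    F G F^T = diag(ep).  Then F^T diag(ep) F = G^-1, since a one-sided inverse of
    a square matrix is two-sided. *)
Lemma orthonormal_inverse a b c d p q r ep1 ep2 :
  ep1 * ep1 = 1 -> ep2 * ep2 = 1 ->
  p*a*a + q*a*b + (q*b*a + r*b*b) = ep1 ->
  p*a*c + q*a*d + (q*b*c + r*b*d) = 0 ->
  p*c*c + q*c*d + (q*d*c + r*d*d) = ep2 ->
  p * r - q * q <> 0 /\
  ep1*a*a + ep2*c*c = r / (p * r - q * q) /\
  ep1*a*b + ep2*c*d = - q / (p * r - q * q) /\
  ep1*b*b + ep2*d*d = p / (p * r - q * q).
Proof.
  intros e1 e2 h1 h2 h3.
  (* det(F)^2 det(G) = ep1 ep2, so both determinants are nonzero. *)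
  assert (hdet : (a * d - b * c) ^ 2 * (p * r - q * q) = ep1 * ep2).
  { replace ((a * d - b * c) ^ 2 * (p * r - q * q)) with
      ((p*a*a + q*a*b + (q*b*a + r*b*b)) * (p*c*c + q*c*d + (q*d*c + r*d*d))
       - (p*a*c + q*a*d + (q*b*c + r*b*d)) ^ 2) by ring.
    rewrite h1, h2, h3; ring. }
  assert (hu : ep1 * ep2 * (ep1 * ep2) = 1).
  { replace (ep1 * ep2 * (ep1 * ep2)) with (ep1 * ep1 * (ep2 * ep2)) by ring.
    rewrite e1, e2; ring. }
  assert (hD : p * r - q * q <> 0).
  { intros h0; rewrite h0 in hdet; rewrite <- hdet in hu; lra. }
  assert (hE : (a * d - b * c) <> 0).
  { intros h0; rewrite h0 in hdet; rewrite <- hdet in hu; lra. }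
  (* adj(F) diag(ep) = det(F) G F^T, entrywise *)
  set (m := a * d - b * c) in *.
  assert (A1 : d * ep1 = m * (p * a + q * b)).
  { unfold m; rewrite <- h1.
    replace (d * (p*a*a + q*a*b + (q*b*a + r*b*b))) with
      ((a*d-b*c)*(p*a+q*b) + b*(p*a*c + q*a*d + (q*b*c + r*b*d))) by ring.
    rewrite h2; ring. }
  assert (A2 : - c * ep1 = m * (q * a + r * b)).
  { unfold m; rewrite <- h1.
    replace (- c * (p*a*a + q*a*b + (q*b*a + r*b*b))) with
      ((a*d-b*c)*(q*a+r*b) - a*(p*a*c + q*a*d + (q*b*c + r*b*d))) by ring.
    rewrite h2; ring. }
  assert (A3 : - b * ep2 = m * (p * c + q * d)).
  { unfold m; rewrite <- h3.
    replace (- b * (p*c*c + q*c*d + (q*d*c + r*d*d))) with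
      ((a*d-b*c)*(p*c+q*d) - d*(p*a*c + q*a*d + (q*b*c + r*b*d))) by ring.
    rewrite h2; ring. }
  assert (A4 : a * ep2 = m * (q * c + r * d)).
  { unfold m; rewrite <- h3.
    replace (a * (p*c*c + q*c*d + (q*d*c + r*d*d))) with
      ((a*d-b*c)*(q*c+r*d) + c*(p*a*c + q*a*d + (q*b*c + r*b*d))) by ring.
    rewrite h2; ring. }
  (* F^T diag(ep) F G = 1, entrywise *)
  assert (B11 : (ep1*a*a + ep2*c*c) * p + (ep1*a*b + ep2*c*d) * q = 1).
  { apply Rmult_eq_reg_l with m; trivial.
    replace (m * _) with (ep1 * a * (m * (p*a + q*b)) + ep2 * c * (m * (p*c+q*d)))
      by ring.
    rewrite <- A1, <- A3.
    replace (_ + _) with (a*d*(ep1*ep1) - b*c*(ep2*ep2)) by ring.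
    rewrite e1, e2; unfold m; ring. }
  assert (B12 : (ep1*a*a + ep2*c*c) * q + (ep1*a*b + ep2*c*d) * r = 0).
  { apply Rmult_eq_reg_l with m; trivial.
    replace (m * _) with (ep1 * a * (m * (q*a + r*b)) + ep2 * c * (m * (q*c+r*d)))
      by ring.
    rewrite <- A2, <- A4.
    replace (_ + _) with (- a*c*(ep1*ep1) + a*c*(ep2*ep2)) by ring.
    rewrite e1, e2; ring. }
  assert (B21 : (ep1*a*b + ep2*c*d) * p + (ep1*b*b + ep2*d*d) * q = 0).
  { apply Rmult_eq_reg_l with m; trivial.
    replace (m * _) with (ep1 * b * (m * (p*a + q*b)) + ep2 * d * (m * (p*c+q*d)))
      by ring.
    rewrite <- A1, <- A3.
    replace (_ + _) with (b*d*(ep1*ep1) - b*d*(ep2*ep2)) by ring.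
    rewrite e1, e2; ring. }
  assert (B22 : (ep1*a*b + ep2*c*d) * q + (ep1*b*b + ep2*d*d) * r = 1).
  { apply Rmult_eq_reg_l with m; trivial.
    replace (m * _) with (ep1 * b * (m * (q*a + r*b)) + ep2 * d * (m * (q*c+r*d)))
      by ring.
    rewrite <- A2, <- A4.
    replace (_ + _) with (- b*c*(ep1*ep1) + a*d*(ep2*ep2)) by ring.
    rewrite e1, e2; unfold m; ring. }
  assert (C1 : (ep1*a*a + ep2*c*c) * (p * r - q * q) = r).
  { transitivity (r * 1 - q * 0); [rewrite <- B11, <- B12; ring | ring]. }
  assert (C2 : (ep1*a*b + ep2*c*d) * (p * r - q * q) = - q).
  { transitivity (p * 0 - q * 1); [rewrite <- B11, <- B12; ring | ring]. }
  assert (C3 : (ep1*b*b + ep2*d*d) * (p * r - q * q) = p).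
  { transitivity (p * 1 - q * 0); [rewrite <- B22, <- B21; ring | ring]. }
  split; [exact hD|].
  split; [|split]; apply Rmult_eq_reg_r with (p * r - q * q); trivial;
    [rewrite C1 | rewrite C2 | rewrite C3]; field; trivial.
Qed.

(** This identity turns frame sums into traces with respect to the metric. *)
Lemma frame_resolves_ginv D g eps e s t :
  is_frame D g eps e -> D s t -> g s t Ds Dt = g s t Dt Ds ->
  forall j k, sum2 (fun a => eps a * e a s t j * e a s t k) = ginv g s t j k.
Proof.
  intros (Heps & _ & He) Hst Hsym j k.
  pose proof (He s t Ds Ds Hst) as h1; pose proof (He s t Ds Dt Hst) as h2.
  pose proof (He s t Dt Dt Hst) as h3.
  assert (e1 : forall a, eps a * eps a = 1)
    by (intros a; destruct (Heps a) as [-> | ->]; ring).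
  unfold ip, sum2, delta in h1, h2, h3; rewrite <- Hsym in h1, h2, h3.
  rewrite Rmult_1_r in h1, h3; rewrite Rmult_0_r in h2.
  destruct (orthonormal_inverse _ _ _ _ _ _ _ _ _ (e1 Ds) (e1 Dt) h1 h2 h3)
    as (_ & C1 & C2 & C3).
  unfold ginv, detg, sum2; rewrite <- Hsym.
  destruct j, k; [exact C1 | exact C2 | rewrite <- C2; ring | exact C3].
Qed.

Lemma vpd_section_comb i (c : axis -> R -> R -> R) (B : axis -> R -> R -> vec4)
    s t (D2 : axis -> vec4) :
  (forall k, is_pd i (c k) s t (pd i (c k) s t)) ->
  (forall k, is_vpd i (B k) s t (D2 k)) ->
  vpd i (fun x y => vsum2 (fun k => vscal (c k x y) (B k x y))) s t
  = vsum2 (fun k => vadd (vscal (pd i (c k) s t) (B k s t))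
                         (vscal (c k s t) (D2 k))).
Proof.
  intros Hc HB; apply vpd_unique; unfold vsum2.
  apply is_vpd_add; apply is_vpd_scal; auto.
Qed.

Lemma is_pd_of_smooth D f i s t :
  smooth D f -> D s t -> is_pd i f s t (pd i f s t).
Proof.
  intros Hf Hst; destruct (Hf 1%nat) as (_ & He & _).
  destruct (He s t Hst); destruct i; now apply Derive_correct.
Qed.

(** Tensoriality of the second covariant derivative: the first derivatives of
    the components of e_i occur both in the iterated derivative along e_i and in
    the derivative along the field of which e_i is the Levi-Civita derivative
    along itself, and cancel.  What is left is a quadratic expression in the
    frame, which [frame_resolves_ginv] sums up. *)
Lemma rough_laplacian_trace L W g eps e phi sig s t
    (D2 : axis -> axis -> vec4) :
  L <> 0 -> AdS L (phi s t) -> W s t -> is_frame W g eps e ->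
  g s t Ds Dt = g s t Dt Ds ->
  (forall i k, is_vpd i (nablaP L phi (coord k) sig) s t (D2 i k)) ->
  rough_laplacian L g eps e phi sig s t
  = vsum2 (fun i => vsum2 (fun k => vscal (ginv g s t i k)
      (vsub (proj L (phi s t) (D2 i k))
            (vsum2 (fun l => vscal (christoffel g s t l i k)
                                   (nablaP L phi (coord l) sig s t)))))).
Proof.
  intros HL HA Hst Hf Hsym HD2.
  assert (Hc : forall a i k, is_pd i (fun x y => e a x y k) s t
                               (pd i (fun x y => e a x y k) s t)).
  { intros a i k; apply is_pd_of_smooth with W; trivial; apply Hf. }
  assert (HB : forall k, proj L (phi s t) (nablaP L phi (coord k) sig s t)
                         = nablaP L phi (coord k) sig s t).
  { intros k; apply proj_tangent; now apply sprod_proj. }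
  assert (Hin : forall a, nablaP L phi (e a s t)
      (fun x y => nablaP L phi (e a x y) sig x y) s t
    = vsum2 (fun i => vscal (e a s t i) (vsum2 (fun k =>
        vadd (vscal (pd i (fun x y => e a x y k) s t)
                    (nablaP L phi (coord k) sig s t))
             (vscal (e a s t k) (proj L (phi s t) (D2 i k))))))).
  { intros a; rewrite nablaP_lin.
    replace (fun x y => nablaP L phi (e a x y) sig x y) with
      (fun x y => vsum2 (fun k => vscal (e a x y k) (nablaP L phi (coord k) sig x y))).
    2:{ apply functional_extensionality; intros x.
        apply functional_extensionality; intros y.
        symmetry; apply nablaP_lin. }
    assert (Hi : forall i, nablaP L phi (coord i) (fun x y => vsum2 (fun k =>
        vscal (e a x y k) (nablaP L phi (coord k) sig x y))) s t
      = vsum2 (fun k =>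
        vadd (vscal (pd i (fun x y => e a x y k) s t)
                    (nablaP L phi (coord k) sig s t))
             (vscal (e a s t k) (proj L (phi s t) (D2 i k))))).
    { intros i; rewrite nablaP_coord.
      rewrite (vpd_section_comb i (fun k x y => e a x y k)
                 (fun k => nablaP L phi (coord k) sig) s t (D2 i)); auto.
      unfold vsum2; rewrite !proj_add, !proj_scal, !HB; reflexivity. }
    unfold vsum2 at 1; rewrite !Hi; reflexivity. }
  (* The derivatives of the frame components cancel, leaving the Hessian. *)
  set (Q := fun i k => vsub (proj L (phi s t) (D2 i k))
        (vsum2 (fun l => vscal (christoffel g s t l i k)
                               (nablaP L phi (coord l) sig s t)))).
  assert (Ha : forall a,
    vsub (nablaP L phi (e a s t) (fun x y => nablaP L phi (e a x y) sig x y) s t)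
         (nablaP L phi (nablaM g (e a) (e a) s t) sig s t)
    = vsum2 (fun i => vsum2 (fun k => vscal (e a s t i * e a s t k) (Q i k)))).
  { intros a; rewrite Hin, (nablaP_lin _ _ (nablaM g (e a) (e a) s t)).
    unfold nablaM, Q; clear.
    generalize (nablaP L phi (coord Ds) sig s t) (nablaP L phi (coord Dt) sig s t).
    generalize (proj L (phi s t) (D2 Ds Ds)) (proj L (phi s t) (D2 Ds Dt))
      (proj L (phi s t) (D2 Dt Ds)) (proj L (phi s t) (D2 Dt Dt)).
    intros; unfold sum2; vec; ring. }
  change (rough_laplacian L g eps e phi sig s t
    = vsum2 (fun i => vsum2 (fun k => vscal (ginv g s t i k) (Q i k)))).
  clearbody Q; unfold vsum2; rewrite <- !(frame_resolves_ginv _ _ _ _ _ _ Hf Hst Hsym).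
  unfold rough_laplacian, vsum2 at 1; rewrite !Ha.
  clear; unfold sum2; vec; ring.
Qed.

Lemma ddir_coord k phi s t : ddir (coord k) phi s t = vpd k phi s t.
Proof. unfold ddir, coord, delta; destruct k; vec; ring. Qed.

(** * Traces of Hessians for conformally rotational metrics *)

Lemma nabla_d_coord L g phi i j s t :
  nabla_d L g phi (coordf i) (coordf j) s t
  = vsub (proj L (phi s t) (vpd i (vpd j phi) s t))
         (vsum2 (fun l => vscal (christoffel g s t l i j) (vpd l phi s t))).
Proof.
  unfold nabla_d, coordf; rewrite nablaP_coord.
  replace (fun x y => ddir (coord j) phi x y) with (vpd j phi).
  2:{ apply functional_extensionality; intros x.
      apply functional_extensionality; intros y; symmetry; apply ddir_coord. }
  f_equal; unfold ddir, nablaM; f_equal; apply functional_extensionality.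
  assert (H0 : forall i k, pd i (fun _ _ : R => coord j k) s t = 0)
    by (intros [|] k; exact (Derive_const (coord j k) _)).
  intros l; unfold sum2; cbv beta; rewrite !H0; unfold coord, delta.
  destruct i, j; f_equal; ring.
Qed.

(** The metric f (ds^2 + rho^2 dt^2), with a conformal factor f of any sign. *)
Definition warped_metric (f rho : R -> R) : metric :=
  fun s t i j => f s * rot_metric rho s t i j.

(** In dimension two the conformal factor f contributes nothing to the first
    order term: its derivative enters the two diagonal Christoffel symbols of
    the s-direction with opposite signs.  Both the tension field and the rough
    Laplacian are traces of this form. *)
Lemma warped_trace (f rho : R -> R) (f' rho' s t : R) (A : axis -> axis -> vec4)
    (B : axis -> vec4) :
  is_derive f s f' -> is_derive rho s rho' -> f s <> 0 -> rho s <> 0 ->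
  let g := warped_metric f rho in
  vsum2 (fun i => vsum2 (fun j => vscal (ginv g s t i j)
    (vsub (A i j)
          (vsum2 (fun l => vscal (christoffel g s t l i j) (B l))))))
  = vscal (/ f s) (vadd (vadd (A Ds Ds) (vscal (/ rho s ^ 2) (A Dt Dt)))
                        (vscal (rho' / rho s) (B Ds))).
Proof.
  intros Hf Hr f0 r0 g.
  assert (Ht : forall i j, pd Dt (fun x y => g x y i j) s t = 0)
    by (intros i j; exact (Derive_const (g s t i j) _)).
  assert (Hss : pd Ds (fun x y => g x y Ds Ds) s t = f').
  { apply is_derive_unique; unfold g, warped_metric, rot_metric.
    apply (is_derive_ext f); [|exact Hf].
    intros x; symmetry; apply Rmult_1_r. }
  assert (Hst : pd Ds (fun x y => g x y Ds Dt) s t = 0).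
  { apply is_derive_unique; unfold g, warped_metric, rot_metric.
    apply (is_derive_ext (fun _ => 0)); [intros x; symmetry; apply Rmult_0_r|].
    apply (is_derive_const (V := R_NormedModule)). }
  assert (Hts : pd Ds (fun x y => g x y Dt Ds) s t = 0) by exact Hst.
  assert (Htt : pd Ds (fun x y => g x y Dt Dt) s t
                = f' * rho s ^ 2 + f s * (2 * rho s * rho')).
  { apply is_derive_unique; unfold g, warped_metric, rot_metric.
    apply (is_derive_Rmult f (fun x => rho x ^ 2)); trivial.
    apply is_derive_eq with (INR 2 * rho' * rho s ^ pred 2); [|cbn; ring].
    now apply is_derive_pow. }
  unfold vsum2, christoffel, sum2; cbv beta.
  rewrite ?Ht, ?Hss, ?Hst, ?Hts, ?Htt.
  unfold ginv, detg, g, warped_metric, rot_metric.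
  vec; field; auto.
Qed.

(** * The moving frame *)

Lemma is_vpd_scal_const i a f s t v :
  is_vpd i f s t v -> is_vpd i (fun x y => vscal a (f x y)) s t (vscal a v).
Proof.
  destruct i;
    [apply (vder_scal_const a (fun x => f x t))
    | apply (vder_scal_const a (fun y => f s y))].
Qed.

Definition profile_at (L : R) (theta rho Y : R -> R) (s : R) : Prop :=
  0 < rho s /\ ex_derive theta s /\
  is_derive rho s (cosh (theta s) / L * rho s) /\
  is_derive Y s (cosh (theta s) / L * Y s + sinh (theta s)).

(** L times the AdS-gradient of log U at the surface, U being the null
    coordinate fixed by the parabolic rotations. *)
Definition unit_grad_U (L : R) (rho Y : R -> R) (s t : R) : vec4 :=
  vsub (vscal (/ L) (surface L rho Y s t)) (Vec 0 (L / rho s) 0 0).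

(** The timelike unit vector tangent to the level set of U and invariant under
    the parabolic rotations: it has no component along the orbits. *)
Definition horo_time (rho Y : R -> R) (s : R) : vec4 := Vec 0 (- Y s / rho s) 1 0.

(** T = X_s, see [surface_ds]. *)
Definition meridian_tangent (L : R) (theta rho Y : R -> R) (s t : R) : vec4 :=
  vadd (vscal (cosh (theta s)) (unit_grad_U L rho Y s t))
       (vscal (sinh (theta s)) (horo_time rho Y s)).

(** E = X_t / rho, see [surface_dt]. *)
Definition parallel_tangent (s t : R) : vec4 := Vec 0 t 0 1.

(** The unit vector orthogonal to T in the plane of w and m, with the sign for
    which k1 and k2 are the principal curvatures. *)
Definition surface_normal (L : R) (theta rho Y : R -> R) (s t : R) : vec4 :=
  vopp (vadd (vscal (sinh (theta s)) (unit_grad_U L rho Y s t))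
             (vscal (cosh (theta s)) (horo_time rho Y s))).

Lemma cosh_sinh_sqr x : cosh x ^ 2 = 1 + sinh x ^ 2.
Proof.
  unfold cosh, sinh.
  assert (H : exp x * exp (- x) = 1)
    by (rewrite <- exp_plus, Rplus_opp_r; apply exp_0).
  nra.
Qed.

Lemma surface_gram_base L rho Y s t :
  L <> 0 -> rho s <> 0 ->
  let X := surface L rho Y s t in let w := unit_grad_U L rho Y s t in
  let m := horo_time rho Y s in let E := parallel_tangent s t in
  sprod X X = - L ^ 2 /\ sprod w w = 1 /\ sprod m m = -1 /\ sprod E E = 1 /\
  sprod w X = 0 /\ sprod m X = 0 /\ sprod E X = 0 /\
  sprod w m = 0 /\ sprod w E = 0 /\ sprod m E = 0.
Proof.
  intros HL Hr; cbv zeta.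
  unfold unit_grad_U, horo_time, parallel_tangent, surface, Vfun, sprod, vsub, vopp, vadd, vscal.
  cbn [cU cV cY cZ]; repeat split; field; auto.
Qed.

Lemma surface_gram L theta rho Y s t :
  L <> 0 -> rho s <> 0 ->
  let X := surface L rho Y s t in let T := meridian_tangent L theta rho Y s t in
  let E := parallel_tangent s t in let N := surface_normal L theta rho Y s t in
  AdS L X /\ sprod T T = 1 /\ sprod E E = 1 /\ sprod N N = -1 /\
  sprod T X = 0 /\ sprod E X = 0 /\ sprod N X = 0 /\
  sprod T E = 0 /\ sprod N T = 0 /\ sprod N E = 0.
Proof.
  intros HL Hr; cbv zeta; unfold AdS, meridian_tangent, surface_normal.
  destruct (surface_gram_base L rho Y s t HL Hr)
    as (H1 & H2 & H3 & H4 & H5 & H6 & H7 & H8 & H9 & H10).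
  pose proof (cosh_sinh_sqr (theta s)) as HC.
  assert (H8' : sprod (horo_time rho Y s) (unit_grad_U L rho Y s t) = 0)
    by (rewrite sprod_comm; exact H8).
  sprod_lin.
  rewrite H1, H2, H3, H4, H5, H6, H7, H8, H8', H9, H10.
  repeat split; nra.
Qed.

Ltac coord_derive Hr HY :=
  auto_derive;
  [ repeat split; trivial; try (eexists; eassumption)
  | eta_derive; rewrite ?(is_derive_unique _ _ _ Hr), ?(is_derive_unique _ _ _ HY) ].

Lemma horo_time_ds L theta rho Y s :
  L <> 0 -> profile_at L theta rho Y s ->
  vder (horo_time rho Y) s (Vec 0 (- sinh (theta s) / rho s) 0 0).
Proof.
  intros HL (r0 & HT & Hr & HY).
  assert (r1 : rho s <> 0) by lra.
  unfold horo_time; vsplit; cbn [cU cV cY cZ]; try apply (is_derive_const (V := R_NormedModule)).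
  coord_derive Hr HY.
  field; split; trivial.
Qed.

Lemma unit_grad_U_ds L theta rho Y s t :
  L <> 0 -> profile_at L theta rho Y s ->
  vder (fun x => unit_grad_U L rho Y x t) s
    (vadd (vscal (/ L) (meridian_tangent L theta rho Y s t))
          (vscal (cosh (theta s)) (Vec 0 (/ rho s) 0 0))).
Proof.
  intros HL (r0 & HT & Hr & HY).
  assert (r1 : rho s <> 0) by lra.
  unfold unit_grad_U, meridian_tangent, unit_grad_U, horo_time, surface, Vfun, vsub, vopp, vadd, vscal.
  vsplit; cbn [cU cV cY cZ]; coord_derive Hr HY; try lra; try (field; auto).
Qed.

Lemma surface_ds L theta rho Y s t :
  L <> 0 -> profile_at L theta rho Y s ->
  is_vpd Ds (surface L rho Y) s t (meridian_tangent L theta rho Y s t).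
Proof.
  intros HL (r0 & HT & Hr & HY).
  assert (r1 : rho s <> 0) by lra.
  unfold meridian_tangent, unit_grad_U, horo_time, surface, Vfun, vsub, vopp, vadd, vscal.
  vsplit; cbn [cU cV cY cZ]; coord_derive Hr HY; try lra; try (field; auto).
Qed.

Lemma surface_dt L rho Y s t :
  is_vpd Dt (surface L rho Y) s t (vscal (rho s) (parallel_tangent s t)).
Proof.
  unfold surface, parallel_tangent, vscal.
  vsplit; cbn [cU cV cY cZ]; auto_derive; trivial; field.
Qed.

Lemma parallel_tangent_ds s t : is_vpd Ds parallel_tangent s t vzero.
Proof. exact (vder_const (Vec 0 t 0 1) s). Qed.

(** E_t is rho times the null vector (0, 1/rho, 0, 0), which lies in the span of
    X and w; expanding w in T and N gives the formula. *)
Lemma parallel_tangent_dt L theta rho Y s t :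
  L <> 0 -> rho s <> 0 ->
  is_vpd Dt parallel_tangent s t
    (vscal (rho s)
       (vadd (vscal (/ L ^ 2) (surface L rho Y s t))
          (vadd (vscal (- (cosh (theta s) / L)) (meridian_tangent L theta rho Y s t))
                (vscal (- k2 L theta s) (surface_normal L theta rho Y s t))))).
Proof.
  intros HL r1.
  apply is_vpd_eq with (Vec 0 1 0 0).
  - vsplit; cbn; auto_derive; trivial.
  - pose proof (cosh_sinh_sqr (theta s)) as HC.
    transitivity (vscal (rho s) (vadd (vscal (/ L ^ 2) (surface L rho Y s t))
      (vscal (- (cosh (theta s) ^ 2 - sinh (theta s) ^ 2) / L) (unit_grad_U L rho Y s t)))).
    + rewrite HC; unfold unit_grad_U, surface; vec; field; auto.
    + unfold meridian_tangent, surface_normal, k2; vec; field; auto.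
Qed.

Lemma unit_grad_U_dt L rho Y s t :
  is_vpd Dt (unit_grad_U L rho Y) s t (vscal (rho s / L) (parallel_tangent s t)).
Proof.
  apply is_vpd_eq with
    (vadd (vscal (/ L) (vscal (rho s) (parallel_tangent s t))) (vscal (-1) vzero));
    [|unfold parallel_tangent; vec; unfold Rdiv; ring].
  exact (vder_add _ _ _ _ _
    (vder_scal_const (/ L) _ _ _ (surface_dt L rho Y s t))
    (vder_scal_const (-1) _ _ _ (vder_const (Vec 0 (L / rho s) 0 0) t))).
Qed.

(** The meridians are geodesics of the surface: T_s has no tangential part. *)
Lemma meridian_tangent_ds L theta rho Y s t :
  L <> 0 -> profile_at L theta rho Y s ->
  is_vpd Ds (meridian_tangent L theta rho Y) s t
    (vadd (vscal (- k1 L theta s) (surface_normal L theta rho Y s t))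
          (vscal (/ L ^ 2) (surface L rho Y s t))).
Proof.
  intros HL HP; pose proof (horo_time_ds L theta rho Y s HL HP) as Hm.
  pose proof (unit_grad_U_ds L theta rho Y s t HL HP) as Hw.
  destruct HP as (r0 & HT & Hr & HY); assert (r1 : rho s <> 0) by lra.
  pose proof (cosh_sinh_sqr (theta s)) as HC.
  eapply is_vpd_eq.
  - unfold meridian_tangent; apply (is_vpd_add Ds).
    + apply (is_vpd_scal Ds (fun x _ => cosh (theta x))); [|exact Hw].
      cbn; auto_derive; [trivial|reflexivity].
    + apply (is_vpd_scal Ds (fun x _ => sinh (theta x)) (fun x _ => horo_time rho Y x));
        [|exact Hm].
      cbn; auto_derive; [trivial|reflexivity].
  - eta_derive; cbv beta.
    transitivity (vadd (vscal (- k1 L theta s) (surface_normal L theta rho Y s t))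
      (vadd (vscal ((cosh (theta s) ^ 2 - sinh (theta s) ^ 2) / L) (unit_grad_U L rho Y s t))
            (vscal (cosh (theta s) ^ 2 - sinh (theta s) ^ 2) (Vec 0 (/ rho s) 0 0)))).
    + unfold meridian_tangent, surface_normal, k1; vec; field; auto.
    + rewrite HC; unfold unit_grad_U, surface; vec; field; auto.
Qed.

Lemma meridian_tangent_dt L theta rho Y s t :
  is_vpd Dt (meridian_tangent L theta rho Y) s t
    (vscal (cosh (theta s) / L * rho s) (parallel_tangent s t)).
Proof.
  eapply is_vpd_eq.
  - exact (vder_add _ _ _ _ _
      (vder_scal_const (cosh (theta s)) _ _ _ (unit_grad_U_dt L rho Y s t))
      (vder_const (vscal (sinh (theta s)) (horo_time rho Y s)) t)).
  - unfold parallel_tangent; vec; unfold Rdiv; ring.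
Qed.

Lemma surface_normal_ds L theta rho Y s t :
  L <> 0 -> profile_at L theta rho Y s ->
  is_vpd Ds (surface_normal L theta rho Y) s t
    (vscal (- k1 L theta s) (meridian_tangent L theta rho Y s t)).
Proof.
  intros HL HP; pose proof (horo_time_ds L theta rho Y s HL HP) as Hm.
  pose proof (unit_grad_U_ds L theta rho Y s t HL HP) as Hw.
  destruct HP as (r0 & HT & Hr & HY); assert (r1 : rho s <> 0) by lra.
  eapply is_vpd_eq.
  - unfold surface_normal, vopp; apply (is_vpd_scal_const Ds), (is_vpd_add Ds).
    + apply (is_vpd_scal Ds (fun x _ => sinh (theta x))); [|exact Hw].
      cbn; auto_derive; [trivial|reflexivity].
    + apply (is_vpd_scal Ds (fun x _ => cosh (theta x)) (fun x _ => horo_time rho Y x));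
        [|exact Hm].
      cbn; auto_derive; [trivial|reflexivity].
  - eta_derive; cbv beta; unfold meridian_tangent, k1; vec; field; auto.
Qed.

Lemma surface_normal_dt L theta rho Y s t :
  is_vpd Dt (surface_normal L theta rho Y) s t
    (vscal (- k2 L theta s * rho s) (parallel_tangent s t)).
Proof.
  eapply is_vpd_eq.
  - exact (vder_scal_const (-1) _ _ _ (vder_add _ _ _ _ _
      (vder_scal_const (sinh (theta s)) _ _ _ (unit_grad_U_dt L rho Y s t))
      (vder_const (vscal (cosh (theta s)) (horo_time rho Y s)) t))).
  - unfold parallel_tangent, k2; vec; unfold Rdiv; ring.
Qed.

(** * Tension and bitension fields *)

Definition coordinate_tangent (L : R) (theta rho Y : R -> R) (i : axis) (s t : R) : vec4 :=
  match i with
  | Ds => meridian_tangent L theta rho Y s t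
  | Dt => vscal (rho s) (parallel_tangent s t)
  end.

Lemma surface_vpd L theta rho Y i s t :
  L <> 0 -> profile_at L theta rho Y s ->
  vpd i (surface L rho Y) s t = coordinate_tangent L theta rho Y i s t.
Proof.
  intros HL HP; apply vpd_unique; destruct i;
    [now apply surface_ds | apply surface_dt].
Qed.

Lemma surface_ddir L theta rho Y v s t :
  L <> 0 -> profile_at L theta rho Y s ->
  ddir v (surface L rho Y) s t
  = vadd (vscal (v Ds) (meridian_tangent L theta rho Y s t))
         (vscal (v Dt * rho s) (parallel_tangent s t)).
Proof.
  intros HL HP; unfold ddir, vsum2.
  rewrite !(surface_vpd L theta) by trivial; cbn [coordinate_tangent]; vec; ring.
Qed.

Lemma surface_pullback L theta rho Y v w s t :
  L <> 0 -> profile_at L theta rho Y s ->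
  pullback (surface L rho Y) s t v w = ip (rot_metric rho) s t v w.
Proof.
  intros HL HP; unfold pullback; rewrite !(surface_ddir L theta) by trivial.
  assert (r0 : rho s <> 0) by (destruct HP; lra).
  destruct (surface_gram L theta rho Y s t HL r0)
    as (_ & H1 & H2 & _ & _ & _ & _ & H3 & _).
  sprod_lin; rewrite H1, H2, (sprod_comm (parallel_tangent s t)), H3.
  unfold ip, sum2, rot_metric; ring.
Qed.

Lemma proj_frame L theta rho Y s t a b c d :
  L <> 0 -> rho s <> 0 ->
  proj L (surface L rho Y s t)
    (vadd (vscal a (surface L rho Y s t))
       (vadd (vscal b (meridian_tangent L theta rho Y s t))
          (vadd (vscal c (parallel_tangent s t)) (vscal d (surface_normal L theta rho Y s t)))))
  = vadd (vscal b (meridian_tangent L theta rho Y s t))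
      (vadd (vscal c (parallel_tangent s t)) (vscal d (surface_normal L theta rho Y s t))).
Proof.
  intros HL Hr.
  destruct (surface_gram L theta rho Y s t HL Hr)
    as (HA & _ & _ & _ & H1 & H2 & H3 & _).
  rewrite !proj_add, !proj_scal, proj_self, !proj_tangent by trivial.
  vec; ring.
Qed.

(** The trace of the second fundamental form is - (k1 + k2) N = 2 H N, and the
    tangential part of X_tt cancels against the first order term
    (rho' / rho) X_s of the trace. *)
Lemma surface_tension D L theta rho Y f f' s t :
  L <> 0 -> open_domain D -> D s t ->
  (forall x y, D x y -> profile_at L theta rho Y x) ->
  is_derive f s f' -> f s <> 0 ->
  tension L (warped_metric f rho) (surface L rho Y) s t
  = vscal (2 * meanH L theta s / f s) (surface_normal L theta rho Y s t).
Proof.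
  intros HL HD Hst HP Hf f0.
  assert (HPs : profile_at L theta rho Y s) by (apply (HP s t); trivial).
  pose proof HPs as (r0 & _ & Hr & _); assert (r1 : rho s <> 0) by lra.
  set (g := warped_metric f rho); set (X := surface L rho Y).
  assert (H2 : forall i j v, is_vpd i (coordinate_tangent L theta rho Y j) s t v ->
                             vpd i (vpd j X) s t = v).
  { intros i j v Hv; apply vpd_unique.
    apply (is_vpd_ext D) with (coordinate_tangent L theta rho Y j); trivial.
    intros x y Hxy; symmetry; apply surface_vpd; trivial; now apply (HP x y). }
  transitivity (vsum2 (fun i => vsum2 (fun j => vscal (ginv g s t i j)
    (vsub (proj L (X s t) (vpd i (vpd j X) s t))
          (vsum2 (fun l => vscal (christoffel g s t l i j) (vpd l X s t))))))).
  { unfold tension, vsum2; rewrite !nabla_d_coord; reflexivity. }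
  unfold g; rewrite (warped_trace f rho f' _ s t
    (fun i j => proj L (X s t) (vpd i (vpd j X) s t)) (fun l => vpd l X s t)
    Hf Hr f0 r1); cbv beta.
  rewrite (H2 Ds Ds _ (meridian_tangent_ds L theta rho Y s t HL HPs)).
  rewrite (H2 Dt Dt _ (vder_scal_const (rho s) _ _ _
             (parallel_tangent_dt L theta rho Y s t HL r1))).
  unfold X; rewrite (surface_vpd L theta) by trivial; cbn [coordinate_tangent].
  replace (vadd (vscal (- k1 L theta s) (surface_normal L theta rho Y s t)) _) with
    (vadd (vscal (/ L ^ 2) (surface L rho Y s t))
       (vadd (vscal 0 (meridian_tangent L theta rho Y s t))
          (vadd (vscal 0 (parallel_tangent s t))
                (vscal (- k1 L theta s) (surface_normal L theta rho Y s t)))))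
    by (vec; ring).
  replace (vscal (rho s) (vscal (rho s) _)) with
    (vadd (vscal (rho s ^ 2 * / L ^ 2) (surface L rho Y s t))
       (vadd (vscal (- rho s ^ 2 * (cosh (theta s) / L)) (meridian_tangent L theta rho Y s t))
          (vadd (vscal 0 (parallel_tangent s t))
             (vscal (- rho s ^ 2 * k2 L theta s) (surface_normal L theta rho Y s t)))))
    by (vec; ring).
  rewrite !proj_frame by trivial.
  unfold meanH, k1, k2; generalize (meridian_tangent L theta rho Y s t) (surface_normal L theta rho Y s t).
  intros T N; vec; field; auto.
Qed.

Lemma is_derive_Ropp (f : R -> R) (x a : R) :
  is_derive f x a -> is_derive (fun y => - f y) x (- a).
Proof. apply (is_derive_opp f). Qed.

(** The coordinate covariant derivatives of the section u N along the surface
    when u' = (H' / k1) u. *)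
Definition nabla_normal_section (L : R) (theta rho Y u : R -> R) (i : axis) (s t : R)
    : vec4 :=
  match i with
  | Ds => vadd (vscal (ratio L theta s * u s) (surface_normal L theta rho Y s t))
               (vscal (- (u s * k1 L theta s)) (meridian_tangent L theta rho Y s t))
  | Dt => vscal (- (u s * k2 L theta s * rho s)) (parallel_tangent s t)
  end.

Lemma nablaP_normal_section D L theta rho Y u sig k s t :
  L <> 0 -> open_domain D -> D s t -> profile_at L theta rho Y s ->
  is_derive u s (ratio L theta s * u s) ->
  (forall x y, D x y -> sig x y = vscal (u x) (surface_normal L theta rho Y x y)) ->
  nablaP L (surface L rho Y) (coord k) sig s t
  = nabla_normal_section L theta rho Y u k s t.
Proof.
  intros HL HD Hst HP Hu Hsig; rewrite nablaP_coord.
  assert (r1 : rho s <> 0) by (destruct HP; lra).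
  destruct (surface_gram L theta rho Y s t HL r1)
    as (HA & _ & _ & _ & H1 & H2 & H3 & _).
  assert (Hv : forall v, is_vpd k (fun x y => vscal (u x) (surface_normal L theta rho Y x y)) s t v ->
                         vpd k sig s t = v).
  { intros v Hv; apply vpd_unique.
    apply (is_vpd_ext D) with (2 := Hst) (4 := Hv); trivial.
    intros; symmetry; auto. }
  destruct k; cbn [nabla_normal_section].
  - rewrite (Hv _ (is_vpd_scal Ds (fun x _ => u x) _ s t _ _ Hu
                     (surface_normal_ds L theta rho Y s t HL HP))).
    rewrite proj_add, !proj_scal, !proj_tangent by trivial; vec; ring.
  - rewrite (Hv _ (vder_scal_const (u s) _ _ _ (surface_normal_dt L theta rho Y s t))).
    rewrite !proj_scal, !proj_tangent by trivial; vec; ring.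
Qed.

(** Here u is the coefficient of N in the tension field, twice the function u of
    the theorem; only its logarithmic derivative H' / k1 and the relation f u = 2 H
    enter. *)
Lemma surface_biharmonic_at (I' J : R -> Prop) L theta rho Y f u W eps e s t :
  L <> 0 -> open I' -> open J -> profile_solution L I' theta ->
  (forall x, I' x -> profile_at L theta rho Y x) ->
  (forall x, I' x -> ex_derive f x /\ f x <> 0 /\
     f x * u x = 2 * meanH L theta x /\ is_derive u x (ratio L theta x * u x) /\
     ex_derive (ratio L theta) x) ->
  open_domain W -> (forall x y, W x y -> rect I' J x y) ->
  is_frame W (warped_metric f rho) eps e -> W s t ->
  bitension L (warped_metric f rho) eps e (surface L rho Y) s t = vzero.
Proof.
  intros HL HI HJ Hth HP Hfu HW HWD He Hst.
  set (g := warped_metric f rho) in *; set (X := surface L rho Y).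
  assert (HD : open_domain (rect I' J)) by now apply open_domain_rect.
  assert (HDst : rect I' J s t) by auto.
  assert (Hs : I' s) by apply HDst.
  assert (HPs : profile_at L theta rho Y s) by auto.
  assert (r1 : rho s <> 0) by (destruct HPs; lra).
  destruct (Hfu s Hs) as ([f' Hf] & f0 & Huf & Hu & [r' Hr']).
  destruct (Hth s Hs) as (_ & k10 & Hode).
  rewrite (is_derive_unique _ _ _ Hr') in Hode.
  destruct (profile_ex_derive L I' theta Hth s Hs) as (d1 & d2 & _).
  pose proof (is_derive_k1 L theta s d1 d2) as Hk1.
  (* The Codazzi equation, with H' written as the ratio times k1. *)
  assert (HC : Derive (Derive theta) s + Derive theta s * cosh (theta s) / L
    = - 2 * ratio L theta s * k1 L theta s
      - cosh (theta s) / L * (k1 L theta s - k2 L theta s)).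
  { pose proof (ratio_eq_of_profile L I' theta s Hth Hs) as E.
    rewrite (is_derive_unique _ _ _ (is_derive_meanH L theta s d1 d2)) in E.
    transitivity (-2 * (ratio L theta s * k1 L theta s)
      - cosh (theta s) / L * (k1 L theta s - k2 L theta s)); [|ring].
    rewrite <- E; unfold k1, k2, Rdiv; generalize (/ L); intros; field. }
  rewrite HC in Hk1; clear HC.
  destruct (surface_gram L theta rho Y s t HL r1)
    as (HA & _ & _ & _ & HTX & HEX & HNX & _ & HNT & HNE).
  set (sig := tension L g X).
  assert (Hsig : forall x y, rect I' J x y ->
                 sig x y = vscal (u x) (surface_normal L theta rho Y x y)).
  { intros x y Hxy; destruct (Hfu x (proj1 Hxy)) as ([fx Hfx] & fx0 & Hux & _).
    unfold sig, g, X.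
    rewrite (surface_tension (rect I' J) L theta rho Y f fx x y HL HD Hxy)
      by (trivial; intros a b [Ha _]; auto).
    f_equal; rewrite <- Hux; field; trivial. }
  assert (HB : forall k x y, rect I' J x y ->
    nablaP L X (coord k) sig x y = nabla_normal_section L theta rho Y u k x y).
  { intros k x y Hxy; destruct (Hfu x (proj1 Hxy)) as (_ & _ & _ & Hux & _).
    apply (nablaP_normal_section (rect I' J)); trivial; apply HP, Hxy. }
  assert (HBd : forall i k v, is_vpd i (nabla_normal_section L theta rho Y u k) s t v ->
                              is_vpd i (nablaP L X (coord k) sig) s t v).
  { intros i k v; apply (is_vpd_ext (rect I' J)); trivial.
    intros x y Hxy; symmetry; auto. }
  pose proof (surface_normal_ds L theta rho Y s t HL HPs) as HNs.
  pose proof (surface_normal_dt L theta rho Y s t) as HNt.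
  pose proof (meridian_tangent_ds L theta rho Y s t HL HPs) as HTs.
  pose proof (meridian_tangent_dt L theta rho Y s t) as HTt.
  pose proof (parallel_tangent_dt L theta rho Y s t HL r1) as HEt.
  pose proof (parallel_tangent_ds s t) as HEs.
  pose proof HPs as (r0 & [th' Hth'] & Hrho & _).
  (* The mixed derivatives only have to exist: the metric is diagonal. *)
  assert (Hk2 : ex_derive (fun x => - (u x * k2 L theta x * rho x)) s).
  { unfold k2; auto_derive; repeat split; eexists; eassumption. }
  destruct Hk2 as [k2' Hk2].
  pose proof (is_vpd_add Ds _ _ s t _ _
    (is_vpd_scal Ds (fun x _ => ratio L theta x * u x) _ s t _ _
       (is_derive_Rmult _ _ _ _ _ Hr' Hu) HNs)
    (is_vpd_scal Ds (fun x _ => - (u x * k1 L theta x)) _ s t _ _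
       (is_derive_Ropp _ _ _ (is_derive_Rmult _ _ _ _ _ Hu Hk1)) HTs)) as Dss.
  pose proof (is_vpd_scal Ds (fun x _ => - (u x * k2 L theta x * rho x)) _ s t _ _
       Hk2 HEs) as Dst.
  pose proof (is_vpd_add Dt _ _ s t _ _
    (is_vpd_scal_const Dt (ratio L theta s * u s) _ s t _ HNt)
    (is_vpd_scal_const Dt (- (u s * k1 L theta s)) _ s t _ HTt)) as Dts.
  pose proof (is_vpd_scal_const Dt (- (u s * k2 L theta s * rho s)) _ s t _ HEt) as Dtt.
  cbv beta in Dss, Dst, Dts, Dtt.
  match type of Dss with is_vpd _ _ _ _ ?a => set (vss := a) in * end.
  match type of Dst with is_vpd _ _ _ _ ?a => set (vst := a) in * end.
  match type of Dts with is_vpd _ _ _ _ ?a => set (vts := a) in * end.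
  match type of Dtt with is_vpd _ _ _ _ ?a => set (vtt := a) in * end.
  unfold bitension; fold sig.
  rewrite (rough_laplacian_trace L W g eps e X sig s t
    (fun i k => match i, k with
                | Ds, Ds => vss | Ds, Dt => vst | Dt, Ds => vts | Dt, Dt => vtt end))
    by (trivial; intros [|] [|]; apply HBd; assumption).
  pose proof (warped_trace f rho f' _ s t (fun i k => proj L (X s t)
    (match i, k with
     | Ds, Ds => vss | Ds, Dt => vst | Dt, Ds => vts | Dt, Dt => vtt end))
    (fun l => nablaP L X (coord l) sig s t) Hf Hrho f0 r1) as Htr.
  cbv zeta beta in Htr; fold g in Htr; rewrite Htr; clear Htr.
  cbv iota; rewrite HB by trivial; cbn [nabla_normal_section].
  rewrite (Hsig s t HDst).
  (* The scalar product of d X (e_i) with itself is eps_i / f, so each i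
     contributes the same multiple of the tension field. *)
  assert (HR : forall i, vscal (eps i)
      (RN L (X s t) (ddir (e i s t) X s t)
         (vscal (u s) (surface_normal L theta rho Y s t)) (ddir (e i s t) X s t))
    = vscal (u s / (f s * L ^ 2)) (surface_normal L theta rho Y s t)).
  { intros i.
    assert (Hd : sprod (ddir (e i s t) X s t) (ddir (e i s t) X s t) = eps i / f s).
    { destruct He as (_ & _ & He); pose proof (He s t i i Hst) as Hi.
      change (pullback X s t (e i s t) (e i s t) = eps i / f s).
      unfold X; rewrite (surface_pullback L theta) by trivial.
      replace (eps i) with (eps i * delta i i) by (destruct i; cbn; ring).
      rewrite <- Hi; unfold g, warped_metric, ip, sum2; field; trivial. }
    rewrite RN_value; trivial.
    - rewrite Hd; unfold X; rewrite (surface_ddir L theta) by trivial.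
      assert (e2 : eps i * eps i = 1)
        by (destruct He as (He & _); destruct (He i) as [-> | ->]; ring).
      sprod_lin; rewrite (sprod_comm _ (surface_normal _ _ _ _ _ _)), HNT.
      rewrite (sprod_comm _ (surface_normal _ _ _ _ _ _)), HNE.
      transitivity (vscal (eps i * eps i * (u s / (f s * L ^ 2)))
                      (surface_normal L theta rho Y s t)); [vec; field; auto|].
      rewrite e2; vec; ring.
    - unfold X; rewrite (surface_ddir L theta) by trivial.
      sprod_lin; rewrite HTX, HEX; ring.
    - sprod_lin; unfold X; rewrite HNX; ring.
    - unfold X; rewrite (surface_ddir L theta) by trivial.
      sprod_lin; rewrite HTX, HEX; ring. }
  unfold vsum2; rewrite !HR.
  unfold vss, vtt, X; rewrite !proj_add, !proj_scal, !proj_add, !proj_scal.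
  rewrite !proj_self, !proj_tangent by trivial.
  (* The coefficient of T vanishes identically, as the Codazzi equation has
     been substituted for k1'. *)
  transitivity (vscal (u s / f s * (r' + ratio L theta s ^ 2
      + cosh (theta s) / L * ratio L theta s + k1 L theta s ^ 2
      + k2 L theta s ^ 2 - 2 / L ^ 2)) (surface_normal L theta rho Y s t)).
  - clear - f0 HL r1.
    generalize (k1 L theta s) (k2 L theta s) (ratio L theta s) (cosh (theta s)).
    generalize (surface_normal L theta rho Y s t) (meridian_tangent L theta rho Y s t).
    intros N T a b c d; vec; field; auto.
  - replace (r' + _ + _ + _ + _ - _) with 0;
      [vec; ring | rewrite <- Hode; unfold k2; field; trivial].
Qed.

(** * Linear differential equations on an interval *)

Lemma interval_Rmin_Rmax (I : R -> Prop) a b c :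
  is_open_interval I -> I a -> I b -> Rmin a b <= c <= Rmax a b -> I c.
Proof.
  intros [_ HI] Ha Hb Hc.
  destruct (Rle_dec a b) as [h|h].
  - rewrite Rmin_left, Rmax_right in Hc by lra; now apply (HI a b).
  - rewrite Rmin_right, Rmax_left in Hc by lra; now apply (HI b a).
Qed.

Lemma is_derive_RInt_interval (I : R -> Prop) (h : R -> R) s :
  is_open_interval I -> I 0 -> (forall x, I x -> ex_derive h x) -> I s ->
  is_derive (fun x => RInt h 0 x) s (h s).
Proof.
  intros HI H0 Hh Hs.
  assert (Hc : forall x, I x -> continuous h x)
    by (intros x Hx; apply (ex_derive_continuous h), Hh, Hx).
  apply (is_derive_RInt h _ 0); [|auto].
  generalize (proj1 HI s Hs); apply filter_imp; intros x Hx.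
  apply (RInt_correct h), (ex_RInt_continuous h).
  intros z Hz; apply Hc, (interval_Rmin_Rmax I 0 x); trivial.
Qed.

(** The quotient of f by the exponential of the primitive of a is constant. *)
Lemma linear_ode_pos (I : R -> Prop) (f a : R -> R) :
  is_open_interval I -> I 0 -> (forall x, I x -> ex_derive a x) ->
  (forall x, I x -> is_derive f x (a x * f x)) -> 0 < f 0 ->
  forall s, I s -> 0 < f s.
Proof.
  intros HI H0 Ha Hf Hf0 s Hs.
  destruct (ex_intro (fun A : R -> R => forall x, I x -> is_derive A x (a x))
    (fun x => RInt a 0 x)
    (fun x Hx => is_derive_RInt_interval I a x HI H0 Ha Hx)) as [A HA].
  set (h := fun x => f x * exp (- A x)).
  assert (Hh : forall x, I x -> is_derive h x 0).
  { intros x Hx; unfold h; pose proof (Hf x Hx) as Hfx; pose proof (HA x Hx) as HAx.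
    auto_derive; [repeat split; eexists; eassumption|].
    eta_derive; rewrite (is_derive_unique _ _ _ Hfx), (is_derive_unique _ _ _ HAx).
    ring. }
  assert (E : h s = h 0).
  { destruct (Rtotal_order 0 s) as [h1|[<-|h1]]; trivial.
    - symmetry; apply (eq_is_derive h 0 s); trivial.
      intros x Hx; apply Hh, (proj2 HI 0 s); trivial.
    - apply (eq_is_derive h s 0); trivial.
      intros x Hx; apply Hh, (proj2 HI s 0); trivial. }
  assert (P : 0 < h s).
  { rewrite E; unfold h; apply Rmult_lt_0_compat; trivial; apply exp_pos. }
  unfold h in P; pose proof (exp_pos (- A s)); nra.
Qed.

Lemma smooth_on_subset (I I' : R -> Prop) f :
  (forall s, I' s -> I s) -> smooth_on I f -> smooth_on I' f.
Proof. intros H Hf n; now apply diff_on_subset with I. Qed.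

Lemma smooth_on_ex_derive I f s : smooth_on I f -> I s -> ex_derive f s.
Proof. intros Hf Hs; now apply (Hf 1%nat). Qed.

(** * The rotational surfaces *)

Ltac smooth_tac :=
  repeat first
    [ assumption | apply smooth_const
    | apply smooth_snd
    | apply smooth_fst; intros n; solve [diff_on_tac]
    | apply smooth_plus
    | apply smooth_mult ].

Lemma surface_smooth (I J : R -> Prop) L rho Y :
  open I -> open J -> smooth_on I rho -> smooth_on I Y ->
  (forall s, I s -> rho s <> 0) ->
  smooth_map (rect I J) (surface L rho Y).
Proof.
  intros HI HJ Hr HY r0; pose proof (open_domain_rect I J HI HJ) as HD.
  assert (Hi : smooth_on I (fun s => / (2 * rho s))).
  { intros n; apply diff_on_inv; trivial; [|diff_on_tac].
    intros s Hs; pose proof (r0 s Hs); lra. }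
  unfold smooth_map, surface, Vfun, Rdiv; cbn [cU cV cY cZ pow].
  vsplit; smooth_tac.
Qed.

Lemma surface_normal_smooth (I J : R -> Prop) L theta rho Y :
  open I -> open J -> smooth_on I theta -> smooth_on I rho -> smooth_on I Y ->
  (forall s, I s -> rho s <> 0) ->
  smooth_map (rect I J) (surface_normal L theta rho Y).
Proof.
  intros HI HJ Ht Hr HY r0; pose proof (open_domain_rect I J HI HJ) as HD.
  assert (Hi : smooth_on I (fun s => / rho s))
    by (intros n; apply diff_on_inv; trivial; apply Hr).
  destruct (surface_smooth I J L rho Y HI HJ Hr HY r0) as (H1 & H2 & H3 & H4).
  unfold smooth_map, surface_normal, unit_grad_U, horo_time, vsub, vopp, vadd, vscal, Rdiv.
  cbn [cU cV cY cZ].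
  vsplit; smooth_tac.
Qed.

Lemma profile_functions_smooth (I : R -> Prop) L theta u0 :
  is_open_interval I -> I 0 -> profile_solution L I theta ->
  (forall s, I s -> is_derive (ufun L theta u0) s
                      (ratio L theta s * ufun L theta u0 s)) /\
  smooth_on I (ratio L theta) /\ smooth_on I (meanH L theta) /\
  smooth_on I (ufun L theta u0).
Proof.
  intros HI H0 Hp; pose proof HI as [HIo _].
  pose proof (profile_smooth L I theta HIo Hp) as Ht.
  assert (Ht1 : smooth_on I (Derive theta)) by (intros n; apply (Ht (S n))).
  assert (HH : smooth_on I (meanH L theta))
    by (intros n; unfold meanH, Rdiv; diff_on_tac).
  assert (HH1 : smooth_on I (Derive (meanH L theta)))
    by (intros n; apply (HH (S n))).
  assert (Hr : smooth_on I (ratio L theta)).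
  { intros n; unfold ratio; apply diff_on_div; trivial; [|unfold k1, Rdiv; diff_on_tac].
    intros s Hs; apply (Hp s Hs). }
  assert (Hu : forall s, I s -> is_derive (ufun L theta u0) s
                      (ratio L theta s * ufun L theta u0 s)).
  { intros s Hs.
    pose proof (is_derive_RInt_interval I (ratio L theta) s HI H0
      (fun x Hx => smooth_on_ex_derive _ _ _ Hr Hx) Hs) as HR.
    unfold ufun.
    apply is_derive_eq with
      (u0 * (ratio L theta s * exp (RInt (ratio L theta) 0 s))); [|ring].
    apply is_derive_scal, (is_derive_comp exp); [apply is_derive_exp | exact HR]. }
  split; [exact Hu|]; split; [exact Hr|]; split; [exact HH|].
  apply smooth_on_linear_ode with (ratio L theta) (fun _ => 0); trivial.
  - intros n; apply diff_on_const.
  - intros s Hs; rewrite Rplus_0_r; auto.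
Qed.

Lemma positive_near (F : R -> R) :
  continuous F 0 -> 0 < F 0 ->
  exists eps : R, 0 < eps /\ forall s, Rabs s < eps -> 0 < F s.
Proof.
  intros Hc HF.
  destruct (Hc _ (open_gt 0 (F 0) HF)) as [d Hd].
  exists d; split; [apply cond_pos|]; intros s Hs; apply Hd.
  unfold ball; cbn; unfold AbsRing_ball, abs, minus, plus, opp; cbn.
  now rewrite Ropp_0, Rplus_0_r.
Qed.

Theorem proposition5p7 (L : R) (hL : 0 < L)
  (I : R -> Prop) (hI : is_open_interval I) (hI0 : I 0)
  (theta : R -> R) (htheta : profile_solution L I theta)
  (rho Y : R -> R) (rho0 Y0 : R) (hrho0 : 0 < rho0)
  (hrho : forall s, I s -> is_derive rho s (cosh (theta s) / L * rho s))
  (hrho_init : rho 0 = rho0)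
  (hY : forall s, I s ->
          is_derive Y s (cosh (theta s) / L * Y s + sinh (theta s)))
  (hY_init : Y 0 = Y0) :
  let X := surface L rho Y in
  (forall J : R -> Prop, is_open_interval J ->
     (forall s t, rect I J s t -> AdS L (X s t)) /\
     spacelike_immersion (rect I J) X /\
     (forall s t, rect I J s t -> forall v w : tvec,
        pullback X s t v w = ip (rot_metric rho) s t v w) /\
     (exists (xi : R -> R -> vec4) (A : R -> R -> axis -> axis -> R),
        timelike_unit_normal (rect I J) X xi /\
        forall s t, rect I J s t ->
          is_shape_operator L X xi s t (A s t) /\
          principal_curvature_along (A s t) (k1 L theta s) (coord Ds) /\
          principal_curvature_along (A s t) (k2 L theta s) (coord Dt))) /\
  (forall theta0 a0 b0 u0 : R,
     analytic_on I theta ->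
     theta 0 = theta0 -> Derive theta 0 = a0 -> Derive_n theta 2 0 = b0 ->
     let k10 := a0 + sinh theta0 / L in
     let H0 := - a0 / 2 - sinh theta0 / L in
     let H0' := - b0 / 2 - a0 * cosh theta0 / L in
     k10 <> 0 -> H0 <> 0 -> H0' <> 0 -> H0 <> k10 -> 0 < u0 / H0 ->
     exists eps : R, 0 < eps /\
       forall I' : R -> Prop,
         is_open_interval I' -> I' 0 ->
         (forall s, I' s -> I s /\ Rabs s < eps) ->
         forall J : R -> Prop, is_open_interval J -> (exists t, J t) ->
           let g' := conf_metric L theta rho u0 in
           (forall s, I' s -> 0 < ufun L theta u0 s / meanH L theta s) /\
           proper_biharmonic L (rect I' J) g' X /\
           conformal_immersion L (rect I' J) g' X /\
           parabolic_rotational_symmetry (rect I' J) X).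
Proof.
  intros X.
  assert (HL : L <> 0) by lra.
  pose proof hI as [HIo _].
  pose proof (profile_smooth L I theta HIo htheta) as Ht.
  assert (Hc : smooth_on I (fun s => cosh (theta s) / L))
    by (intros n; unfold Rdiv; diff_on_tac).
  assert (Hrpos : forall s, I s -> 0 < rho s).
  { apply (linear_ode_pos I rho (fun s => cosh (theta s) / L)); trivial; [|lra].
    intros x Hx; exact (smooth_on_ex_derive _ _ _ Hc Hx). }
  assert (HP : forall s, I s -> profile_at L theta rho Y s).
  { intros s Hs; split; [auto|].
    split; [exact (smooth_on_ex_derive _ _ _ Ht Hs) | auto]. }
  assert (Hrs : smooth_on I rho).
  { apply smooth_on_linear_ode with (fun s => cosh (theta s) / L) (fun _ => 0);
      trivial; [intros n; apply diff_on_const|].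
    intros s Hs; rewrite Rplus_0_r; auto. }
  assert (HYs : smooth_on I Y).
  { apply smooth_on_linear_ode with (fun s => cosh (theta s) / L)
      (fun s => sinh (theta s)); trivial; intros n; diff_on_tac. }
  assert (r0 : forall s, I s -> rho s <> 0)
    by (intros s Hs; pose proof (Hrpos s Hs); lra).
  assert (HAdS : forall s t, I s -> AdS L (X s t))
    by (intros s t Hs; apply (surface_gram L theta); auto).
  assert (Hsm : forall I' J, (forall s, I' s -> I s) -> open I' -> open J ->
                  smooth_map (rect I' J) X).
  { intros I' J Hsub HI' HJ; apply surface_smooth; auto;
      now apply (smooth_on_subset I). }
  assert (Hpull : forall s t v, I s ->
    pullback X s t v v = v Ds ^ 2 + (rho s * v Dt) ^ 2).
  { intros s t v Hs; unfold X; rewrite (surface_pullback L theta) by auto.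
    unfold ip, sum2, rot_metric; ring. }
  assert (Himm : forall I' J, (forall s, I' s -> I s) -> open I' -> open J ->
                   immersion (rect I' J) X).
  { intros I' J Hsub HI' HJ; split; [auto|]; intros s t v [Hs _] Hv.
    pose proof (Hpull s t v (Hsub s Hs)) as E; unfold pullback in E.
    rewrite Hv in E; unfold sprod in E; cbn [cU cV cY cZ vzero] in E.
    pose proof (Hrpos s (Hsub s Hs)) as r1.
    assert (E1 : v Ds = 0) by nra.
    assert (E2 : rho s * v Dt = 0) by nra.
    intros [|]; [exact E1|].
    destruct (Rmult_integral _ _ E2); [lra|assumption]. }
  split.
  - intros J HJ; pose proof HJ as [HJo _].
    split; [intros s t [Hs _]; auto|]; split; [|split].
    + split; [apply Himm; auto|]; intros s t v [Hs _] [i Hi].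
      rewrite Hpull by trivial; pose proof (Hrpos s Hs) as r1.
      pose proof (pow2_ge_0 (v Ds)); pose proof (pow2_ge_0 (rho s * v Dt)).
      destruct i.
      * pose proof (pow2_gt_0 _ Hi); lra.
      * assert (rho s * v Dt <> 0)
          by (apply Rmult_integral_contrapositive; split; lra).
        pose proof (pow2_gt_0 (rho s * v Dt)); lra.
    + intros s t [Hs _] v w; apply (surface_pullback L theta); auto.
    + exists (surface_normal L theta rho Y), (fun s _ i j => match i, j with
        | Ds, Ds => k1 L theta s | Dt, Dt => k2 L theta s | _, _ => 0 end).
      split; [split; [now apply surface_normal_smooth|]|].
      * intros s t [Hs _].
        destruct (surface_gram L theta rho Y s t HL (r0 s Hs))
          as (_ & _ & _ & H1 & _ & _ & H2 & _ & H3 & H4).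
        split; [exact H1|]; split; [exact H2|].
        intros v; unfold X; rewrite (surface_ddir L theta) by auto.
        sprod_lin; rewrite H3, H4; ring.
      * intros s t [Hs _]; split.
        -- intros W; unfold X.
           destruct (surface_gram L theta rho Y s t HL (r0 s Hs))
             as (HA & _ & _ & _ & H1 & H2 & _).
           rewrite (surface_ddir L theta) by auto.
           unfold nablaP, ddir, vsum2.
           rewrite (vpd_unique Ds _ _ _ _ (surface_normal_ds L theta rho Y s t HL (HP s Hs))).
           rewrite (vpd_unique Dt _ _ _ _ (surface_normal_dt L theta rho Y s t)).
           rewrite proj_add, !proj_scal, !proj_tangent by trivial.
           unfold mxapp, sum2; vec; ring.
        -- split; (split; [|intros [|]; unfold mxapp, sum2, coord, delta; ring]).
           ++ exists Ds; exact R1_neq_R0.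
           ++ exists Dt; exact R1_neq_R0.
  - intros theta0 a0 b0 u0 _ Hth0 Ha0 _ k10 H0 H0' _ HH0 _ _ Hu0.
    destruct (profile_functions_smooth I L theta u0 hI hI0 htheta)
      as (Hu & Hrat & HHs & Hus).
    set (u := ufun L theta u0) in *; set (H := meanH L theta) in *.
    assert (HH00 : H 0 = H0) by (unfold H, meanH, H0; rewrite Hth0, Ha0; trivial).
    assert (Hu00 : u 0 = u0)
      by (unfold u, ufun; rewrite RInt_point; cbn; rewrite exp_0; ring).
    destruct (positive_near (fun s => u s / H s)) as (eps & Heps & Hpos).
    { apply (ex_derive_continuous (fun s => u s / H s)), ex_derive_div.
      - exact (smooth_on_ex_derive _ _ _ Hus hI0).
      - exact (smooth_on_ex_derive _ _ _ HHs hI0).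
      - now rewrite HH00. }
    { now rewrite HH00, Hu00. }
    exists eps; split; trivial.
    intros I' HI' HI'0 Hsub J HJ [t0 Ht0] g'.
    pose proof HI' as [HI'o _]; pose proof HJ as [HJo _].
    assert (HII : forall s, I' s -> I s) by (intros s Hs; now apply Hsub).
    assert (Hq : forall s, I' s -> 0 < u s / H s)
      by (intros s Hs; apply Hpos, Hsub, Hs).
    (* In R the inverse of 0 is 0, so a positive quotient has a nonzero
       denominator. *)
    assert (HH : forall s, I' s -> H s <> 0).
    { intros s Hs E; pose proof (Hq s Hs) as P; unfold Rdiv in P.
      rewrite E, Rinv_0 in P; lra. }
    assert (Huz : forall s, I' s -> u s <> 0).
    { intros s Hs E; pose proof (Hq s Hs) as P; unfold Rdiv in P.
      rewrite E in P; lra. }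
    set (lam := lambda L theta u0).
    assert (Hlpos : forall s, I' s -> 0 < lam s)
      by (intros s Hs; apply sqrt_lt_R0; exact (Hq s Hs)).
    assert (Hl2 : forall s, I' s -> lam s ^ 2 = u s / H s).
    { intros s Hs; unfold lam, lambda; apply pow2_sqrt.
      left; exact (Hq s Hs). }
    assert (Hls : smooth_on I' lam).
    { intros n; unfold lam, lambda; apply diff_on_sqrt; trivial.
      apply diff_on_div; trivial;
        [apply (smooth_on_subset I) with (1 := HII) (2 := Hus)
        |apply (smooth_on_subset I) with (1 := HII) (2 := HHs)]. }
    set (f := fun s => / lam s ^ 2).
    assert (Hfs : smooth_on I' f).
    { intros n; unfold f; apply diff_on_inv; trivial; [|diff_on_tac].
      intros s Hs; pose proof (Hlpos s Hs); nra. }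
    assert (Hf : forall s, I' s -> f s = H s / u s).
    { intros s Hs; unfold f; rewrite (Hl2 s Hs); field; auto. }
    assert (f0 : forall s, I' s -> f s <> 0).
    { intros s Hs; rewrite Hf by trivial; unfold Rdiv.
      apply Rmult_integral_contrapositive; split; auto using Rinv_neq_0_compat. }
    change g' with (warped_metric f rho) in *; clear g'.
    pose proof (open_domain_rect I' J HI'o HJo) as HD.
    pose proof (smooth_on_subset I I' rho HII Hrs) as Hrs'.
    assert (Hinto : smooth_into_AdS L (rect I' J) X)
      by (split; [apply Hsm; auto | intros s t [Hs _]; auto]).
    assert (Hps : pseudo_metric (rect I' J) (warped_metric f rho)).
    { split; [|split].
      - intros i j; unfold warped_metric, rot_metric; destruct i, j;
          apply smooth_fst; intros n; diff_on_tac.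
      - intros s t [|] [|] _; reflexivity.
      - intros s t [Hs _]; unfold detg, warped_metric, rot_metric.
        pose proof (f0 s Hs) as f1; pose proof (r0 s (HII s Hs)) as r1.
        replace (_ - _) with ((f s * rho s) ^ 2) by ring.
        apply pow_nonzero, Rmult_integral_contrapositive; auto. }
    assert (Hfd : forall s, I' s -> ex_derive f s)
      by (intros s Hs; exact (smooth_on_ex_derive _ _ _ Hfs Hs)).
    split; [exact Hq|]; split; [|split].
    + split; [split; [exact Hinto|]; split; [exact Hps|]|].
      * intros W e0 e HW HWD He s t Hst.
        apply (surface_biharmonic_at I' J L theta rho Y f (fun x => 2 * u x) W);
          trivial; [intros x Hx; auto .. |].
        intros x Hx; split; [auto|]; split; [auto|]; split; [|split].
        -- rewrite Hf by trivial; fold H; field; auto.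
        -- apply is_derive_eq with (2 * (ratio L theta x * u x)); [|ring].
           apply is_derive_scal; auto.
        -- exact (smooth_on_ex_derive _ _ _ Hrat (HII x Hx)).
      * exists 0, t0; split; [split; trivial|].
        destruct (Hfd 0 HI'0) as [f' Hf'].
        unfold X; rewrite (surface_tension (rect I' J) L theta rho Y f f');
          trivial; [|split; trivial | intros x y [Hx _]; auto | auto].
        intros E; destruct (surface_gram L theta rho Y 0 t0 HL (r0 0 hI0))
          as (_ & _ & _ & H1 & _).
        apply (f_equal (fun v => sprod v (surface_normal L theta rho Y 0 t0))) in E.
        rewrite sprod_scal_l, H1 in E.
        replace (sprod vzero _) with 0 in E by (unfold sprod; cbn; ring).
        fold H in E; rewrite HH00 in E; pose proof (f0 0 HI'0) as f1.
        apply HH0; apply Rmult_eq_reg_r with (-2 / f 0).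
        -- transitivity (2 * H0 / f 0 * -1); [field; trivial | rewrite E; ring].
        -- intros E2; apply R1_neq_R0.
           replace 1 with (-2 / f 0 * (- f 0 / 2)) by (field; trivial).
           rewrite E2; ring.
    + split; [exact Hinto|]; split; [exact Hps|]; split; [apply Himm; auto|].
      exists (fun s _ => lam s); split; [apply smooth_fst; exact Hls|].
      intros s t [Hs _]; split; [auto|]; intros v w.
      unfold X; rewrite (surface_pullback L theta) by auto.
      unfold warped_metric, f, ip, sum2; field.
      pose proof (Hlpos s Hs); lra.
    + exists (fun s => X s 0); intros s t _; unfold X, surface, parab.
      cbn [cU cV cY cZ]; f_equal; ring.
Qed.
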